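(* Let $f:\mathbb{R}^n\to\mathbb{R}^n$ be a local diffeomorphism. Suppose that for each $v\in S^{n-1}$ there exists a complete Riemannian metric $g_v$ on $\mathbb{R}^n$ such that $$\inf_{x\in\mathbb{R}^n}\,|\nabla^{g_v} f_v(x)|_{g_v}>0 .$$ Then $f$ is bijective.
   Context: $S^{n-1}$ is the Euclidean unit sphere of $\mathbb{R}^n$. For $v\in S^{n-1}$, $f_v:\mathbb{R}^n\to\mathbb{R}$ is the height function $f_v(x)=\langle f(x),v\rangle$ (Euclidean inner product). For a Riemannian metric $g$ on $\mathbb{R}^n$ and a smooth function $h:\mathbb{R}^n\to\mathbb{R}$, the gradient $\nabla^g h$ of $h$ relative to $g$ is defined by $g_x(\nabla^g h,w)=dh_x(w)$ for all $w\in\mathbb{R}^n$, and $|\cdot|_g$ is the norm induced by $g$. *)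

(* Defs.v *)
From HB Require Import structures.
From mathcomp Require Import all_boot all_order all_algebra.
From mathcomp Require Import all_classical all_reals all_analysis.
Set Implicit Arguments.
Unset Strict Implicit.
Unset Printing Implicit Defensive.
Import Order.TTheory GRing.Theory Num.Theory.
Import numFieldNormedType.Exports.
Local Open Scope classical_set_scope.
Local Open Scope ring_scope.

(* R^n is 'rV[R]_n. Its topology (given by the max norm) is the usual one; the *)
(* Euclidean inner product is dot below.                                       *)

Section Smooth.
Context {R : realType} {V W : normedModType R}.

(* C^k on an open set U. In finite dimension, x |-> 'd f x is C^k iff          *)
(* x |-> 'd f x v is C^k for every fixed v.                                    *)
Fixpoint Ck_on (k : nat) (U : set V) (f : V -> W) : Prop :=
  match k with
  | 0 => forall x, U x -> {for x, continuous f}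
  | k'.+1 => (forall x, U x -> differentiable f x) /\
             (forall v, Ck_on k' U (fun x => 'd f x v))
  end.

Definition smooth_on (U : set V) (f : V -> W) : Prop :=
  forall k, Ck_on k U f.

End Smooth.

Definition local_diffeomorphism (R : realType) (V W : normedModType R)
    (f : V -> W) : Prop :=
  forall x, exists (U : set V) (U' : set W) (h : W -> V),
    [/\ open U, U x & open U'] /\
    [/\ set_bij U U' f, {in U, cancel f h},
        smooth_on U f & smooth_on U' h].

Section Euclidean.
Context {R : realType} {n : nat}.
Implicit Types u v : 'rV[R]_n.

Definition dot u v : R := \sum_(i < n) u 0 i * v 0 i.

Definition unit_sphere : set 'rV[R]_n := [set v | Num.sqrt (dot v v) = 1].

Definition height (f : 'rV[R]_n -> 'rV[R]_n) v : 'rV[R]_n -> R :=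
  fun x => dot (f x) v.

End Euclidean.

Section Riemannian.
Context {R : realType} {n : nat}.
Local Notation E := 'rV[R]_n.
(* g x is the Gram matrix of the metric at x in the standard basis. *)
Implicit Types (g : E -> 'M[R]_n) (x y u w : E).

Definition metric_form g x u w : R := (u *m g x *m w^T) 0 0.

Definition riemannian_metric g : Prop :=
  [/\ smooth_on setT g,
      forall x, (g x)^T = g x &
      forall x u, u != 0 -> 0 < metric_form g x u u].

Definition metric_norm g x u : R := Num.sqrt (metric_form g x u u).

Definition gradient g (h : E -> R) x : E :=
  xget 0 [set u | forall w, metric_form g x u w = 'd h x w].

(* Continuous curves on [0, 1] which are C^1 on each closed interval of some   *)
(* subdivision 0 < s_0 < ... < s_k = 1; a curve is C^1 on a closed interval    *)
(* when it agrees there with a C^1 curve defined on the whole line. Values of  *)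
(* c outside [0, 1] play no role.                                              *)
Definition piecewise_C1 (c : R -> E) : Prop :=
  exists s : seq R,
    [/\ path <%R 0 s, last 0 s = 1 &
        forall i, (i < size s)%N -> exists e : R -> E,
          Ck_on 1 setT e /\
          {in `[nth 0 (0 :: s) i, nth 0 s i], c =1 e}].

(* derive1 c is only meaningful off the finitely many subdivision points,     *)
(* which are negligible.                                                       *)
Definition curve_length g (c : R -> E) : R :=
  \int[lebesgue_measure]_(t in `[0, 1]) metric_norm g (c t) (derive1 c t).

Definition riemannian_dist g x y : R :=
  inf [set l | exists c : R -> E,
    [/\ piecewise_C1 c, c 0 = x, c 1 = y & l = curve_length g c]].

Definition complete_metric g : Prop :=
  forall u : nat -> E,
    (forall eps : R, 0 < eps -> exists N, forall i j, (N <= i)%N -> (N <= j)%N ->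
       riemannian_dist g (u i) (u j) < eps) ->
    exists l : E, riemannian_dist g (u k) l @[k --> \oo] --> 0.

(* The set defining the gradient is a singleton. *)
Lemma gradientP g (h : E -> R) x : riemannian_metric g ->
  forall w, metric_form g x (gradient g h x) w = 'd h x w.
Proof.
move=> [_ _ gpos].
have gU : g x \in unitmx.
  rewrite -row_free_unit -kermx_eq0; apply/rowV0P => u /sub_kermxP ug0.
  apply/eqP/negPn/negP => /(gpos x).
  by rewrite /metric_form ug0 mul0mx mxE ltxx.
rewrite /gradient; case: xgetP => [u _ //|/(_ (\row_i 'd h x (delta_mx 0 i) *m invmx (g x)))].
case=> w; rewrite /metric_form mulmxKV//.
rewrite {2}(row_sum_delta w) linear_sum mxE; apply: eq_bigr => i _.
by rewrite linearZ !mxE mulrC.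
Qed.

Lemma gradient_unique g (h : E -> R) x u : riemannian_metric g ->
  (forall w, metric_form g x u w = 'd h x w) -> u = gradient g h x.
Proof.
move=> gR uP; have [_ _ gpos] := gR.
apply/eqP; rewrite -subr_eq0; apply/negPn/negP => /(gpos x).
have e w : metric_form g x (u - gradient g h x) w = 0.
  have := gradientP h x gR w; rewrite -(uP w) /metric_form !mulmxBl !mxE => ->.
  by rewrite subrr.
by rewrite e ltxx.
Qed.

End Riemannian.

(* Main.v *)
Require Import Defs.
From HB Require Import structures.
From mathcomp Require Import all_boot all_order all_algebra.
From mathcomp Require Import all_classical all_reals all_analysis.
From mathcomp Require Import measurable_realfun.
From mathcomp Require Import ring lra.
Set Implicit Arguments.
Unset Strict Implicit.
Unset Printing Implicit Defensive.
Import Order.TTheory GRing.Theory Num.Theory.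
Import numFieldNormedType.Exports.
Local Open Scope ring_scope.

(* For a unit vector v and a real c, completeness and the slope bound allow one
   to push any compact set, by a small-step Euler scheme along the normalized
   gradient, into {f_v > c} without moving the points of {f_v >= c + eps}. So
   a continuous map from a closed subset of a compact space to the half-space
   preimage {x | <f x - y, v> > 0} always extends to the whole space. By
   induction on the number of coordinates of v that vary, the same is true for
   a continuously varying half-space: given v(z) <> 0 on a compact space, a
   partial continuous selection s with <f (s z) - y, v z> > 0 extends.
   Surjectivity: select over the unit sphere with v z = z; the field f (s z) - y
   points outwards on the sphere, so it vanishes somewhere in the ball.
   Injectivity: if f a = f b = y with a <> b, the local inverses of f at a and
   at b, composed with z |-> y + eps z, give selections over the spheres |z| = 2
   and |z| = 1. Extending them to the shell and filling the inner ball with the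
   local inverse at b gives a map G of the ball that avoids a and is the local
   inverse at a on the boundary; then z |-> df_a (G z - a) points outwards on the
   boundary and has no zero, which is absurd. *)

(** * Zeros of outward pointing fields *)

(** The obstacle is that the metrics for different v are unrelated: nothing says how g_v depends on
    v, so their gradient flows do not fit into a family continuous in v. Each metric is therefore
    used for one direction only, to prove [pushable], and the passage to a varying v is purely
    topological. Positivity is an open condition, so a solution for a frozen coordinate survives in
    a slab; and because extension is available over every compact space, in particular over products
    with an interval, two slab solutions can be joined by a homotopy. A push has to be continuous
    and to reach a level, nothing more, so Euler polygons do the work of a flow. Completeness enters
    only through the boundedness of polygons of bounded length; for this, distances are estimated
    from above by polygons and from below by functions of slope at most 1. The only global
    topological input is the existence of a zero of an outward pointing field, obtained by counting
    mod 2 on cubical grids. *)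

Section GridParity.
Variable n : nat.
Implicit Types (p q : 'I_n -> nat) (A B : {set 'I_n}) (a b : 'I_n).

Definition upd p a k : 'I_n -> nat := fun j => if j == a then k else p j.
Definition step p a := upd p a (p a).+1.

Lemma upd_comm p a b k l : a != b -> upd (upd p a k) b l = upd (upd p b l) a k.
Proof.
move=> ab; apply/funext => j; rewrite /upd.
by case: (eqVneq j b) => [->|//]; rewrite eq_sym (negbTE ab).
Qed.

Lemma upd_upd p a k l : upd (upd p a k) a l = upd p a l.
Proof. by apply/funext => j; rewrite /upd; case: eqP. Qed.

Lemma updE p a k : upd p a k a = k.
Proof. by rewrite /upd eqxx. Qed.

Lemma updN p a b k : b != a -> upd p a k b = p b.
Proof. by rewrite /upd => /negbTE ->. Qed.

Lemma step_comm p a b : a != b -> step (step p a) b = step (step p b) a.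
Proof.
move=> ab; rewrite /step !updN // 1?eq_sym //.
by rewrite upd_comm.
Qed.

(** Labels mod 2 of the grid points; in the application [chi i p] is the sign of the i-th coordinate
    of a field at p. The index is a natural number so that [cup] can recurse on it. *)
Variable chi : nat -> ('I_n -> nat) -> 'F_2.

Lemma addF2 (x : 'F_2) : x + x = 0.
Proof. by rewrite -mulr2n -mulr_natr (pchar_Fp_0 (isT : prime 2)) mulr0. Qed.

Lemma addF2_eq0 (x y : 'F_2) : x + y = 0 -> x = y.
Proof. by move/(congr1 (+%R^~ y)); rewrite -addrA addF2 addr0 add0r. Qed.

(** Each unordered pair is counted twice, in characteristic 2. *)
Lemma sum_sym0 A (G : 'I_n -> 'I_n -> 'F_2) : (forall a b, G a b = G b a) ->
  \sum_(a in A) \sum_(b in A :\ a) G a b = 0.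
Proof.
move=> Gs.
pose S1 := \sum_(a in A) \sum_(b in A | (a < b)%N) G a b.
pose S2 := \sum_(a in A) \sum_(b in A | (b < a)%N) G a b.
have -> : \sum_(a in A) \sum_(b in A :\ a) G a b = S1 + S2.
  rewrite -big_split; apply: eq_bigr => a aA /=.
  rewrite (bigID (fun b : 'I_n => a < b)%N) /=; congr (_ + _); apply: eq_bigl => b.
    by rewrite in_setD1; case: (eqVneq b a) => [->|_]; rewrite ?ltnn ?andbF.
  by rewrite in_setD1 -leqNgt ltn_neqAle val_eqE -andbA andbCA.
have -> : S2 = S1.
  rewrite /S1 /S2 (exchange_big_dep (fun b => b \in A)) /=; last by move=> i j _ /andP[].
  by apply: eq_bigr => a aA; apply: eq_big => b; rewrite ?aA.
exact: addF2.
Qed.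

Lemma sum_swap A (G : 'I_n -> 'I_n -> 'F_2) :
  \sum_(a in A) \sum_(b in A :\ a) G a b = \sum_(a in A) \sum_(b in A :\ a) G b a.
Proof.
rewrite (exchange_big_dep (fun b => b \in A)) /=; last by move=> i j _ /setD1P[].
by apply: eq_bigr => a aA; apply: eq_bigl => b; rewrite !in_setD1 aA andbT eq_sym andbC.
Qed.

Lemma setD1C A a b : A :\ a :\ b = A :\ b :\ a.
Proof. by apply/setP => j; rewrite !inE andbCA. Qed.

(* The cup product d(chi_i) u d(chi_(i+1)) u ... (k factors) on the cube with
   lower vertex p and directions A: one term for each ordering of A, that is
   for each monotone edge path from p to the opposite vertex. *)
Fixpoint cup k i A p : 'F_2 :=
  if k is k'.+1 then
    \sum_(a in A) (chi i p + chi i (step p a)) * cup k' i.+1 (A :\ a) (step p a)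
  else 1.

(** A product of exact cochains is closed. In the inductive step T4, and T1 after use of the
    induction hypothesis, sum a symmetric function of two directions, while T2 and T3 cancel each
    other. *)
Lemma cup_cocycle k i A p :
  \sum_(b in A) (cup k i (A :\ b) p + cup k i (A :\ b) (step p b)) = 0.
Proof.
elim: k i A p => [|k IH] i A p /=; first by rewrite big1 // => b _; exact: addF2.
pose w B q := cup k i.+1 B q.
have IH' B q : \sum_(b in B) w (B :\ b) (step q b) = \sum_(b in B) w (B :\ b) q.
  by have := IH i.+1 B q; rewrite big_split /= => /addF2_eq0.
rewrite big_split /=.
under eq_bigr do (under eq_bigr do rewrite mulrDl; rewrite big_split /=).
rewrite big_split /=.
under [X in _ + X]eq_bigr do (under eq_bigr do rewrite mulrDl; rewrite big_split /=).
rewrite [X in _ + X]big_split /=.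
set T1 := (X in X + _ + _ = 0); set T2 := (X in _ + X + _ = 0).
set T3 := (X in _ + (X + _) = 0); set T4 := (X in _ + (_ + X) = 0).
have -> : T4 = 0.
  apply: sum_sym0 => a b; rewrite (setD1C A a b).
  by case: (eqVneq a b) => [->//|ab]; rewrite (step_comm p ab).
have -> : T1 = 0.
  rewrite /T1; under eq_bigr do rewrite -mulr_sumr IH'.
  rewrite -mulr_sumr [X in _ * X]sum_sym0 ?mulr0// => a b; by rewrite setD1C.
rewrite add0r addr0 /T2 sum_swap.
have -> : T3 = \sum_(a in A) \sum_(b in A :\ a) chi i (step p a) * w (A :\ b :\ a) (step p a).
  rewrite /T3; apply: eq_bigr => a aA; rewrite -!mulr_sumr; congr (_ * _).
  by rewrite IH'; apply: eq_bigr => b _; rewrite setD1C.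
exact: addF2.
Qed.

(** The Leibniz rule: by [cup_cocycle] the factor next to [chi i p] may be evaluated at p instead of
    [step p a]. Every term then belongs to a single facet, so that terms of neighbouring cubes
    cancel. *)
Lemma cup_coboundary k i A p :
  cup k.+1 i A p = \sum_(a in A) (chi i p * cup k i.+1 (A :\ a) p
    + chi i (step p a) * cup k i.+1 (A :\ a) (step p a)).
Proof.
rewrite /=; under eq_bigr do rewrite mulrDl.
rewrite !big_split /=; congr (_ + _); rewrite -!mulr_sumr; congr (_ * _).
by have := cup_cocycle k i.+1 A p; rewrite big_split /= => /addF2_eq0.
Qed.

Definition in_cube A p q := forall j, q j = p j \/ (j \in A /\ q j = (p j).+1).

(** Every monotone path contributes a product with a factor d(chi_j), which vanishes on each edge of
    the cube. *)
Lemma cup_const k i A p j : (i <= j < i + k)%N ->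
  (forall q, in_cube A p q -> chi j q = chi j p) -> cup k i A p = 0.
Proof.
elim: k i A p => [|k IH] i A p /=; first by rewrite addn0 leqNgt; case: ltnP.
move=> ij chij; rewrite big1 // => a aA.
have stepc : in_cube A p (step p a).
  by move=> l; rewrite /step /upd; case: eqP => [->|_]; [right|left].
case: (eqVneq i j) => [->|ij']; first by rewrite (chij _ stepc) addF2 mul0r.
rewrite (IH i.+1) ?mulr0//.
  by case/andP: ij => ij jk; rewrite addSnnS jk ltn_neqAle ij' ij.
move=> q qc; rewrite !chij// => l; have := qc l; rewrite /step /upd.
case: eqP => [->|_]; last by move=> [|[/setD1P[_ ?]]]; [left|right].
by move=> [|[]]; [right|rewrite !inE eqxx].
Qed.

(* Sums over the boxes [0, N)^s, the coordinates outside s being frozen. *)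
Variable N : nat.

Definition sum_dir a (F : ('I_n -> nat) -> 'F_2) p := \sum_(k < N) F (upd p a k).
Fixpoint sum_box (s : seq 'I_n) F p : 'F_2 :=
  if s is a :: s' then sum_dir a (sum_box s' F) p else F p.

Lemma sum_box_sum s (A : {set 'I_n}) (F : 'I_n -> _) p :
  sum_box s (fun q => \sum_(a in A) F a q) p = \sum_(a in A) sum_box s (F a) p.
Proof.
elim: s p => //= a s IH p; rewrite /sum_dir exchange_big /=.
by apply: eq_bigr => k _; exact: IH.
Qed.

Lemma sum_box_neq0 s F p : sum_box s F p != 0 ->
  exists q, [/\ F q != 0, forall j, j \in s -> (q j < N)%N & forall j, j \notin s -> q j = p j].
Proof.
elim: s p => [|a s IH] p /=; first by move=> ?; exists p.
move=> nz; have [/existsP[k knz]|/existsPn z] := boolP [exists k : 'I_N, sum_box s F (upd p a k) != 0].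
  have [q [qF qs qp]] := IH _ knz; exists q; split=> // j.
    rewrite inE => /orP[/eqP ->|/qs//].
    have [/qs//|/qp ->] := boolP (a \in s); by rewrite updE.
  by rewrite inE negb_or => /andP[ja js]; rewrite qp// updN.
by move: nz; rewrite /sum_dir big1 ?eqxx// => k _; apply/eqP; rewrite -[_ == _]negbK.
Qed.

Lemma sum_box_upd s F p a k : a \notin s ->
  sum_box s (fun q => F (upd q a k)) p = sum_box s F (upd p a k).
Proof.
elim: s p => //= b s IH p; rewrite inE negb_or => /andP[ab ans].
by rewrite /sum_dir; apply: eq_bigr => l _; rewrite IH// upd_comm// eq_sym.
Qed.

Lemma sum_box_rem s F p a : uniq s -> a \in s ->
  sum_box s F p = sum_box (rem a s) (sum_dir a F) p.
Proof.
elim: s p => //= b s IH p /andP[bs us]; rewrite inE.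
case: (eqVneq b a) => [<- _|ba].
  rewrite /sum_dir -[RHS]/(sum_box s _ p).
  under eq_bigr => k do rewrite -sum_box_upd//.
  elim: s p {IH bs us} => //= c s IH p.
  rewrite /sum_dir exchange_big /=; apply: eq_bigr => l _; exact: IH.
move=> /= ans; rewrite /sum_dir; apply: eq_bigr => k _.
exact: IH.
Qed.

Lemma sum_dir_telescope a F p :
  sum_dir a (fun q => F q + F (step q a)) p = F (upd p a 0) + F (upd p a N).
Proof.
rewrite /sum_dir.
under eq_bigr do rewrite /step upd_upd updE.
elim: N => [|m IH]; first by rewrite big_ord0 addF2.
by rewrite big_ord_recr /= IH addrA -(addrA (F _)) addF2 addr0.
Qed.

Hypothesis chi0 : forall (i : 'I_n) p, p i = 0%N -> chi i p = 0.
Hypothesis chiN : forall (i : 'I_n) p, p i = N -> chi i p = 1.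

Definition dirs i := [seq j : 'I_n <- enum 'I_n | (i <= j)%N].

(* Stokes: the cup product is the coboundary of chi_i u d(chi_(i+1)) u ..., so
   its sum over the box reduces to the faces; only the face p i = N survives. *)
Lemma sum_box_cup k i p : (k + i)%N = n -> (forall j : 'I_n, (j < i)%N -> p j = N) ->
  sum_box (dirs i) (cup k i [set j : 'I_n | (i <= j)%N]) p = 1.
Proof.
elim: k i p => [|k IH] i p kin pN.
  have -> : dirs i = [::]; last by [].
  apply/eqP; rewrite -[_ == _]negbK -has_filter; apply/hasPn => j _.
  by rewrite -ltnNge; move: kin; rewrite add0n => ->.
have ltin : (i < n)%N by rewrite -kin addSn ltnS leq_addl.
pose oi := Ordinal ltin.
under [X in sum_box _ X]funext do rewrite cup_coboundary.
set D := [set j : 'I_n | (i <= j)%N].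
have udirs : uniq (dirs i) by rewrite filter_uniq// enum_uniq.
have mem_dirs j : (j \in dirs i) = (i <= j)%N by rewrite mem_filter mem_enum andbT.
rewrite sum_box_sum (bigD1 oi) ?inE//= [X in _ + X]big1.
  rewrite addr0 (sum_box_rem _ _ udirs (_ : oi \in _)) ?mem_dirs//.
  pose F q := chi i q * cup k i.+1 (D :\ oi) q.
  rewrite -[X in sum_box _ X]/(sum_dir oi (fun q => F q + F (step q oi))).
  under [X in sum_box _ X]funext do rewrite sum_dir_telescope.
  have F0 q : F (upd q oi 0) = 0 by rewrite /F (chi0 (i := oi)) ?updE// mul0r.
  have FN q : F (upd q oi N) = cup k i.+1 [set j : 'I_n | (i < j)%N] (upd q oi N).
    rewrite /F (chiN (i := oi)) ?updE// mul1r; congr cup.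
    by apply/setP => j; rewrite !inE -val_eqE /= ltn_neqAle eq_sym.
  under [X in sum_box _ X]funext do rewrite F0 FN add0r.
  have -> : rem oi (dirs i) = dirs i.+1.
    rewrite rem_filter// -filter_predI; apply: eq_filter => j /=.
    by rewrite -val_eqE /= ltn_neqAle eq_sym.
  rewrite (sum_box_upd _ _ _ (_ : oi \notin _)) ?mem_filter ?ltnn//.
  apply: IH => [|j]; first by rewrite addnS -addSn.
  rewrite ltnS leq_eqVlt => /orP[/eqP ji|ji]; last by rewrite updN ?pN// -val_eqE ltn_eqF.
  by rewrite (_ : j = oi) ?updE//; apply/val_inj.
(* On the two faces orthogonal to a direction a > i the label [chi a] is constant by the boundary
   conditions, and it is one of the remaining factors. *)
move=> a /andP[]; rewrite inE => ia ai.
rewrite (sum_box_rem _ _ udirs (_ : a \in _)) ?mem_dirs//.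
pose F q := chi i q * cup k i.+1 (D :\ a) q.
rewrite -[X in sum_box _ X]/(sum_dir a (fun q => F q + F (step q a))).
under [X in sum_box _ X]funext do rewrite sum_dir_telescope.
have cup0 q : (q a == 0%N) || (q a == N) -> F q = 0.
  move=> qa; rewrite /F (@cup_const _ _ _ _ a) ?mulr0//.
    rewrite addSnnS addnC kin ltn_ord andbT ltn_neqAle ia andbT.
    by apply: contra ai => /eqP ia'; apply/eqP/val_inj.
  move=> q' /(_ a)[q'a|[]]; last by rewrite !inE eqxx.
  by case/orP: qa => /eqP qa; [rewrite !chi0|rewrite !chiN] => //; rewrite q'a.
elim: (rem _ _) p {pN} => [|b s IHs] p /=; first by rewrite !cup0 ?updE ?eqxx ?orbT ?addr0.
by rewrite /sum_dir big1.
Qed.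

(** A cubical form of Sperner's lemma: the full cup products sum to 1, so one of them is nonzero,
    and by [cup_const] no label is constant on its cube. *)
Lemma exists_alternating_cube : exists p, (forall j, (p j < N)%N) /\
  forall j : 'I_n, exists q, in_cube [set: 'I_n] p q /\ chi j q != chi j p.
Proof.
have T1 : sum_box (dirs 0) (cup n 0 [set j : 'I_n | (0 <= j)%N]) (fun=> 0%N) = 1.
  by apply: sum_box_cup; rewrite ?addn0.
have /sum_box_neq0[p [cp ps _]] : sum_box (dirs 0) (cup n 0 [set j : 'I_n | (0 <= j)%N]) (fun=> 0%N) != 0.
  by rewrite T1 oner_neq0.
exists p; split=> [j|j]; first by apply: ps; rewrite mem_filter mem_enum.
apply: contrapT => H; move/eqP: cp; apply; apply: (@cup_const _ _ _ _ j); first by rewrite add0n ltn_ord.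
move=> q qp; apply/eqP/negPn/negP => qj; apply: H; exists q; split=> // l.
Qed.
End GridParity.

Local Open Scope classical_set_scope.
Local Open Scope ring_scope.

(** * Continuity and norms in R^n *)

Section RowVectors.
Local Open Scope classical_set_scope.
Context {R : realType}.
Implicit Types (T : topologicalType).

Lemma mx_norm_ler {m n} (A : 'M[R]_(m, n)) r : 0 <= r ->
  (`|A| <= r) = [forall i, forall j, `|A i j| <= r].
Proof.
move=> r0; rewrite [in LHS]/Num.norm /= mx_normrE; apply/idP/idP.
  move=> /bigmax_leP[_ H]; apply/forallP => i; apply/forallP => j.
  exact: (H (i, j)).
move=> H; apply/bigmax_leP; split=> // -[i j] _ /=.
by have /forallP/(_ i)/forallP := H; apply.
Qed.

Lemma coord_le_norm {m n} (A : 'M[R]_(m, n)) i j : `|A i j| <= `|A|.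
Proof.
by have := mx_norm_ler A (normr_ge0 A); rewrite lexx => /esym/forallP/(_ i)/forallP/(_ j).
Qed.

Lemma row_norm_le {n} (x : 'rV[R]_n) r : 0 <= r ->
  (forall i, `|x 0 i| <= r) -> `|x| <= r.
Proof.
move=> r0 xr; rewrite mx_norm_ler//; apply/forallP => i; apply/forallP => j.
by rewrite (ord1 i).
Qed.

Lemma mx_cvg {T : Type} (F : set_system T) {FF : Filter F} {m n} (f : T -> 'M[R]_(m, n)) (A : 'M[R]_(m, n)) :
  (forall i j, f x i j @[x --> F] --> A i j) -> f @ F --> A.
Proof.
move=> fA; apply/cvgrPdist_le => e e0.
have : forall ij : 'I_m * 'I_n, \forall x \near F, `|A ij.1 ij.2 - f x ij.1 ij.2| <= e.
  by move=> [i j]; have /cvgrPdist_le := fA i j; apply.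
move=> /filter_forall; apply: filterS => x H.
rewrite mx_norm_ler ?ltW//; apply/forallP => i; apply/forallP => j.
by have := H (i, j); rewrite !mxE.
Qed.

Lemma mx_continuous {T} {m n} (f : T -> 'M[R]_(m, n)) :
  (forall i j, continuous (fun x => f x i j)) -> continuous f.
Proof. by move=> fc x; apply: mx_cvg => i j; exact: fc. Qed.

Lemma coord_cont {T} {m n} (f : T -> 'M[R]_(m, n)) i j :
  continuous f -> continuous (fun x => f x i j).
Proof.
move=> fc x; apply: (@continuous_comp _ _ _ f (fun M : 'M[R]_(m, n) => M i j)); first exact: fc.
exact: coord_continuous.
Qed.

Lemma sum_cont {T} (I : Type) (r : seq I) (P : pred I) (f : I -> T -> R) :
  (forall i, continuous (f i)) -> continuous (fun x => \sum_(i <- r | P i) f i x).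
Proof.
move=> fc; elim: r => [|i r IH] x.
  by under eq_fun do rewrite big_nil; exact: cvg_cst.
under eq_fun do rewrite big_cons; case: ifP => _; last exact: IH.
by apply: cvgD; [exact: fc|exact: IH].
Qed.

Lemma prod_cont {T} (I : Type) (r : seq I) (P : pred I) (f : I -> T -> R) :
  (forall i, continuous (f i)) -> continuous (fun x => \prod_(i <- r | P i) f i x).
Proof.
move=> fc; elim: r => [|i r IH] x.
  by under eq_fun do rewrite big_nil; exact: cvg_cst.
under eq_fun do rewrite big_cons; case: ifP => _; last exact: IH.
by apply: cvgM; [exact: fc|exact: IH].
Qed.

Lemma cst_cont {T U : topologicalType} (a : U) : continuous (fun _ : T => a).
Proof. by move=> x; exact: cvg_cst. Qed.

Lemma id_cont {T} : continuous (fun x : T => x).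
Proof. by move=> x; exact: cvg_id. Qed.

Lemma comp_cont {T U V : topologicalType} (f : T -> U) (g : U -> V) :
  continuous f -> continuous g -> continuous (fun x => g (f x)).
Proof. by move=> fc gc x; apply: (@continuous_comp _ _ _ f g); [exact: fc|exact: gc]. Qed.

Lemma add_cont {T} {V : normedModType R} (u v : T -> V) :
  continuous u -> continuous v -> continuous (fun x => u x + v x).
Proof. by move=> uc vc x; apply: cvgD; [exact: uc|exact: vc]. Qed.

Lemma sub_cont {T} {V : normedModType R} (u v : T -> V) :
  continuous u -> continuous v -> continuous (fun x => u x - v x).
Proof. by move=> uc vc x; apply: cvgB; [exact: uc|exact: vc]. Qed.

Lemma mul_cont {T} (u v : T -> R) :
  continuous u -> continuous v -> continuous (fun x => u x * v x).
Proof. by move=> uc vc x; apply: cvgM; [exact: uc|exact: vc]. Qed.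

Lemma scale_cont {T} {V : normedModType R} (u : T -> R) (v : T -> V) :
  continuous u -> continuous v -> continuous (fun x => u x *: v x).
Proof. by move=> uc vc x; apply: cvgZ; [exact: uc|exact: vc]. Qed.

Lemma inv_cont {T} (u : T -> R) : (forall x, u x != 0) ->
  continuous u -> continuous (fun x => (u x)^-1).
Proof. by move=> u0 uc x; apply: cvgV; [exact: u0|exact: uc]. Qed.

Lemma max_cont {T} (u v : T -> R) :
  continuous u -> continuous v -> continuous (fun x => Num.max (u x) (v x)).
Proof. by move=> uc vc x; apply: continuous_max; [exact: uc|exact: vc]. Qed.

Lemma min_cont {T} (u v : T -> R) :
  continuous u -> continuous v -> continuous (fun x => Num.min (u x) (v x)).
Proof. by move=> uc vc x; apply: continuous_min; [exact: uc|exact: vc]. Qed.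

Lemma norm_cont {T} {V : normedModType R} (u : T -> V) :
  continuous u -> continuous (fun x => `|u x|).
Proof. by move=> uc x; apply: cvg_norm; exact: uc. Qed.

Context {n : nat}.
Local Notation E := 'rV[R]_n.

Lemma dot_cont {T} (u v : T -> E) : continuous u -> continuous v ->
  continuous (fun x => dot (u x) (v x)).
Proof.
by move=> uc vc; apply: sum_cont => i x; apply: cvgM; exact: coord_cont.
Qed.

Lemma dotDl (u v w : E) : dot (u + v) w = dot u w + dot v w.
Proof. by rewrite /dot -big_split; apply: eq_bigr => i _; rewrite !mxE mulrDl. Qed.

Lemma dotZl a (u w : E) : dot (a *: u) w = a * dot u w.
Proof. by rewrite /dot mulr_sumr; apply: eq_bigr => i _; rewrite !mxE mulrA. Qed.

Lemma dotC (u v : E) : dot u v = dot v u.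
Proof. by apply: eq_bigr => i _; rewrite mulrC. Qed.

Lemma dotBl (u v w : E) : dot (u - v) w = dot u w - dot v w.
Proof. by rewrite dotDl -scaleN1r dotZl mulN1r. Qed.

Lemma dot_ge0 (u : E) : 0 <= dot u u.
Proof. by apply: sumr_ge0 => i _; rewrite -expr2 sqr_ge0. Qed.

Lemma dot_gt0 (u : E) : u != 0 -> 0 < dot u u.
Proof.
move=> u0; rewrite lt_def dot_ge0 andbT; apply: contra u0 => /eqP d0.
apply/eqP/rowP => i; rewrite mxE; apply/eqP; rewrite -sqrf_eq0.
by move/eqP: d0; rewrite psumr_eq0 => [/allP/(_ i)|j _];
   rewrite -?expr2 ?sqr_ge0// mem_index_enum => /(_ isT).
Qed.

(** The norm of row vectors is the max norm, whence the factor n, here and in later constants. *)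
Lemma norm_dot (u w : E) : `|dot u w| <= n%:R * `|u| * `|w|.
Proof.
rewrite (le_trans (ler_norm_sum _ _ _))//.
have -> : n%:R * `|u| * `|w| = \sum_(i < n) `|u| * `|w|.
  by rewrite sumr_const card_ord -mulrA -[in RHS]mulr_natl.
apply: ler_sum => i _; rewrite normrM ler_pM//; exact: coord_le_norm.
Qed.

Lemma norm_sqr_le_dot (u : E) : `|u| ^+ 2 <= dot u u.
Proof.
suff : `|u| <= Num.sqrt (dot u u).
  by move=> H; rewrite -[leRHS]sqr_sqrtr ?dot_ge0// ler_pXn2r ?nnegrE ?sqrtr_ge0.
apply: row_norm_le => [|i]; first exact: sqrtr_ge0.
rewrite -sqrtr_sqr ler_sqrt ?dot_ge0// /dot (bigD1 i)//= expr2 lerDl.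
by apply: sumr_ge0 => j _; rewrite -expr2 sqr_ge0.
Qed.

Lemma closed_ball_compact (r : R) : compact [set x : E | `|x| <= r].
Proof.
apply: bounded_closed_compact.
  by exists r; split; [exact: num_real|move=> M rM x /= xr; exact: le_trans xr (ltW rM)].
apply: (@closed_comp _ _ (fun x : E => `|x|) [set y | y <= r]); last exact: closed_le.
by move=> x _; exact: norm_continuous.
Qed.

Lemma compact_norm_le (K : set E) : compact K -> exists2 r, 0 < r & forall x, K x -> `|x| <= r.
Proof.
move=> /compact_bounded[M [_ MK]]; exists (Num.max 1 (M + 1)).
  by rewrite lt_max ltr01.
by move=> x Kx; apply: MK => //; rewrite lt_max ltrDl ltr01 orbT.
Qed.

End RowVectors.

(** * From grids to zeros of continuous fields *)

Section Zero.
Local Open Scope classical_set_scope.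
Context {R : realType} {n : nat}.
Local Notation E := 'rV[R]_n.

(* On a fine grid with no nearby zero, every small cube has a coordinate of F
   of constant sign, contradicting exists_alternating_cube for the signs of F. *)
Lemma identity_outside_zero (F : E -> E) : continuous F ->
  (forall z, 2 <= `|z| -> F z = z) -> exists2 z, `|z| <= 2 & F z = 0.
Proof.
move=> Fc Fid; apply: contrapT => nz.
have Fnz z : `|z| <= 2 -> F z != 0.
  by move=> z2; apply/eqP => Fz; apply: nz; exists z.
(* One coordinate of F keeps its sign within eta of x; compactness of the ball will give one eta for
   all x. *)
pose P (eta : R) (x : E) := exists i, forall y, `|y - x| <= eta -> (0 < F y 0 i) = (0 < F x 0 i).
have /compact_near_coveringP/(_ _ (0^'+) P) := @closed_ball_compact R n 2.
have H : forall x : E, `|x| <= 2 -> \forall x' \near x & eta \near 0^'+, P eta x'.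
  move=> x /Fnz Fx.
  have [i Fxi] : exists i, F x 0 i != 0.
    apply: contrapT => Fx0; move/eqP: Fx; apply; apply/rowP => i; rewrite mxE.
    by apply/eqP/negPn/negP => ?; apply: Fx0; exists i.
  have /cvgrPdist_lt /(_ `|F x 0 i|) := (coord_cont (i := 0) (j := i) Fc) x.
  rewrite normr_gt0 => /(_ Fxi) /nbhs_ballP[e /= e0 He].
  exists (ball x (e / 2), [set t | 0 < t < e / 2]); first split => /=.
  - by apply: nbhsx_ballx; rewrite divr_gt0.
  - near=> t; apply/andP; split; near: t; first exact: nbhs_right_gt.
    by apply: nbhs_right_lt; rewrite divr_gt0.
  move=> [x' eta] /= [xx' /andP[eta0 etae]]; exists i => y yx'.
  have sgn w : ball x e w -> (0 < F w 0 i) = (0 < F x 0 i).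
    move=> /He /= hw; move: hw; rewrite ltr_norml.
    have [p|m|p] := ltgtP (F x 0 i) 0; last by rewrite p eqxx in Fxi.
      rewrite ltr0_norm// opprK => /andP[a b].
      by apply/negbTE; rewrite -leNgt; lra.
    by rewrite gtr0_norm// => /andP[a b]; lra.
  move: xx'; rewrite -ball_normE /= => xx'.
  rewrite (sgn y) ?(sgn x')// -ball_normE /=.
    by rewrite (lt_le_trans xx')// ler_pdivrMr// ler_peMr ?ler1n// ltW.
  rewrite (le_lt_trans (ler_distD x' _ _))// (splitr e) ltrD// distrC.
  exact: le_lt_trans yx' etae.
move=> /(_ _ H) {}H.
have [N [N0 HN]] : exists N : nat, (0 < N)%N /\ forall x : E, `|x| <= 2 -> P (4 / N%:R) x.
  move: H; rewrite near_withinE => /nbhs_ballP[e /= e0 He].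
  have lt4 := archi_boundP (divr_ge0 (ler0n R 4) (ltW e0)).
  have N0 : (0 < Num.bound (4 / e))%N by rewrite -(ltr0n R) (le_lt_trans _ lt4)// divr_ge0// ltW.
  exists (Num.bound (4 / e)); split=> //.
  apply: He; last by rewrite divr_gt0// ltr0n.
  rewrite -ball_normE /= sub0r normrN ger0_norm ?divr_ge0//.
  by rewrite ltr_pdivrMr ?ltr0n// mulrC -ltr_pdivrMr.
(* The grid fills the cube [-2, 2]^n, which is the ball of radius 2 for the max norm; its mesh 4 / N
   is the radius in [HN]. *)
pose pt (p : 'I_n -> nat) : E := \row_j (4 * (p j)%:R / N%:R - 2).
have ptE p j : pt p 0 j = 4 * (p j)%:R / N%:R - 2 by rewrite mxE.
pose chi (i : nat) p : 'F_2 := (nat_of_bool [exists j : 'I_n, (j == i :> nat) && (0 < F (pt p) 0 j)])%:R.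
have chiE (i : 'I_n) p : chi i p = (nat_of_bool (0 < F (pt p) 0 i))%:R.
  rewrite /chi; congr (nat_of_bool _)%:R; apply/existsP/idP => [[j /andP[/eqP ji]]|H'].
    by rewrite (val_inj ji).
  by exists i; rewrite eqxx.
have Nn0 : N%:R != 0 :> R by rewrite pnatr_eq0 -lt0n.
have face p (i : 'I_n) : `|pt p 0 i| = 2 -> F (pt p) = pt p.
  by move=> pi; apply: Fid; rewrite -pi; exact: coord_le_norm.
have [||p [pN Hp]] := @exists_alternating_cube n chi N.
- move=> i p pi; have ptpi : pt p 0 i = - 2 by rewrite ptE pi mulr0 mul0r sub0r.
  by rewrite chiE (@face _ i) ptpi ?normrN ?ger0_norm// oppr_gt0 ltrn0.
- move=> i p pi; have ptpi : pt p 0 i = 2 by rewrite ptE pi mulfK//; lra.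
  by rewrite chiE (@face _ i) ptpi ?ger0_norm// ltr0n.
have ptp2 : `|pt p| <= 2.
  apply: row_norm_le => // i; rewrite ptE ler_norml.
  have : (p i)%:R / N%:R <= 1 :> R by rewrite ler_pdivrMr ?ltr0n// mul1r ler_nat ltnW.
  have : 0 <= (p i)%:R / N%:R :> R by rewrite divr_ge0.
  by rewrite -mulrA; lra.
have [i Hi] := HN _ ptp2.
have [q [qp]] := Hp i; rewrite !chiE Hi ?eqxx//.
apply: row_norm_le => [|j]; first by rewrite divr_ge0.
rewrite mxE [X in _ + X]mxE !ptE; have [->|[_ ->]] := qp j.
  by rewrite subrr normr0 divr_ge0.
rewrite -(natr1 (p j)) (_ : _ - _ = 4 / N%:R); last by field.
have h : 0 <= 4 / N%:R :> R by rewrite divr_ge0.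
by rewrite (ger0_norm h).
Unshelve. all: by end_near.
Qed.

(** Reduction to [identity_outside_zero] by adding the shell between radii 1 and 2, where the
    boundary values of F are deformed linearly into the identity. Both ends have positive product
    with z, so no zero arises in the shell. *)
Lemma acute_field_zero (F : E -> E) : continuous F ->
  (forall z, `|z| = 1 -> 0 < dot (F z) z) -> exists2 z, `|z| <= 1 & F z = 0.
Proof.
move=> Fc Facute.
pose rho (z : E) := Num.max 1 `|z|.
have rho1 z : 1 <= rho z by rewrite le_max lexx.
have rhoc : continuous rho by apply: max_cont; [exact: cst_cont|apply: norm_cont; exact: id_cont].
have rho0 z : 0 < rho z := lt_le_trans ltr01 (rho1 z).
(* This is F z for |z| <= 1, (2 - |z|) F(z / |z|) + (|z| - 1) z in the shell, and z for |z| >= 2. *)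
pose G z := Num.max 0 (2 - rho z) *: F ((rho z)^-1 *: z) + (Num.min (rho z) 2 - 1) *: z.
have Gc : continuous G.
  apply: add_cont; apply: scale_cont; last exact: id_cont.
  - by apply: max_cont; [exact: cst_cont|apply: sub_cont => //; exact: cst_cont].
  - apply: (comp_cont _ Fc); apply: scale_cont; last exact: id_cont.
    by apply: inv_cont => // z; rewrite gt_eqF.
  - by apply: sub_cont; [apply: min_cont => //|]; exact: cst_cont.
have [z z2|z z2 Gz] := identity_outside_zero Gc.
  have rz : rho z = `|z| by rewrite /rho; apply: max_r; lra.
  rewrite /G rz; have -> : Num.max 0 (2 - `|z|) = 0 by apply: max_l; lra.
  by rewrite scale0r add0r (min_r z2) (_ : 2 - 1 = 1) ?scale1r//; lra.
have [z1|z1] := leP `|z| 1.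
  exists z => //; move: Gz; rewrite /G.
  have -> : rho z = 1 by apply: max_l.
  have -> : Num.max 0 (2 - 1 : R) = 1 by rewrite max_r; lra.
  have -> : Num.min 1 2 = 1 :> R by apply: min_l; lra.
  by rewrite subrr scale0r addr0 invr1 !scale1r.
have rz : rho z = `|z| by rewrite /rho; apply: max_r; exact: ltW.
pose w := `|z|^-1 *: z.
have w1 : `|w| = 1 by rewrite normrZ normfV normr_id mulVf// gt_eqF// (lt_trans _ z1).
have zw : z = `|z| *: w by rewrite scalerA mulfV ?scale1r// gt_eqF// (lt_trans _ z1).
have : dot (G z) w = 0 by rewrite Gz /dot big1// => i _; rewrite mxE mul0r.
rewrite /G dotDl !dotZl rz -/w (_ : dot z w = `|z| * dot w w); last by rewrite -dotZl -zw.
have -> : Num.max 0 (2 - `|z|) = 2 - `|z| by apply: max_r; lra.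
have -> : Num.min `|z| 2 = `|z| by apply: min_l.
have := Facute _ w1; have : 0 < dot w w.
  by apply: dot_gt0; rewrite -normr_gt0 w1.
move=> ww Fw /eqP; rewrite gt_eqF// ltr_wpDl// ?mulr_ge0 ?subr_ge0 ?(ltW Fw)//.
by rewrite mulrA !mulr_gt0// ?subr_gt0// (lt_trans _ z1).
Qed.
End Zero.

(** * Continuous selections in varying half-spaces *)

Section Selection.
Local Open Scope classical_set_scope.
Context {R : realType} {n : nat}.
Local Notation E := 'rV[R]_n.

(** Pasting on the union of A and B, then Tietze's theorem for each coordinate; compactness supplies
    the bound that its bounded form requires. *)
Lemma continuous_glue (Y : pseudoMetricType R) (A B : set Y) (s1 s2 : Y -> E) :
  compact A -> closed A -> compact B -> closed B -> continuous s1 -> continuous s2 ->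
  (forall x, A x -> B x -> s1 x = s2 x) ->
  exists s, [/\ continuous s, forall x, A x -> s x = s1 x & forall x, B x -> s x = s2 x].
Proof.
move=> Ac Acl Bc Bcl s1c s2c s12.
pose s0 x := if `[< A x >] then s1 x else s2 x.
have s0A x : A x -> s0 x = s1 x by rewrite /s0; case: asboolP.
have s0B x : B x -> s0 x = s2 x by rewrite /s0; case: asboolP => // Ax /(s12 _ Ax).
have bnd (C : set Y) (u : Y -> E) : compact C -> continuous u -> exists2 M, 0 < M & forall x, C x -> `|u x| <= M.
  move=> Cc uc; have [|M M0 HM] := @compact_norm_le R n (u @` C).
    by apply: continuous_compact => //; exact: continuous_subspaceT.
  by exists M => // x Cx; apply: HM; exists x.
have [M1 M10 HM1] := bnd _ _ Ac s1c; have [M2 M20 HM2] := bnd _ _ Bc s2c.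
have : forall i : 'I_n, exists g : Y -> R, continuous g /\ forall x, (A `|` B) x -> g x = s0 x 0 i.
  move=> i.
  have [||x ABx|g [gs gc _]] := @continuous_bounded_extension Y R pseudometric_normal (A `|` B)
      (closedU Acl Bcl) (fun x => s0 x 0 i : R^o) (M1 + M2).
  - by rewrite addr_gt0.
  - apply: withinU_continuous => //.
      apply: (@subspace_eq_continuous _ A _ (fun x => s1 x 0 i : R^o) (fun x => s0 x 0 i : R^o)).
        by move=> x /set_mem /s0A <-.
      by apply: continuous_subspaceT; exact: coord_cont.
    apply: (@subspace_eq_continuous _ B _ (fun x => s2 x 0 i : R^o) (fun x => s0 x 0 i : R^o)).
      by move=> x /set_mem /s0B <-.
    by apply: continuous_subspaceT; exact: coord_cont.
  - apply: le_trans (coord_le_norm _ _ _) _; case: ABx => [Ax|Bx].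
      by rewrite s0A// (le_trans (HM1 _ Ax))// lerDl ltW.
    by rewrite s0B// (le_trans (HM2 _ Bx))// lerDr ltW.
  - by exists g; split=> // x ABx; rewrite gs// inE.
move=> /fin_all_exists[g Hg].
exists (fun x => \row_i g i x); split.
- apply: mx_continuous => a i; under eq_fun do rewrite mxE; by case: (Hg i).
- by move=> x Ax; apply/rowP => i; rewrite mxE (Hg i).2 ?s0A//; left.
- by move=> x Bx; apply/rowP => i; rewrite mxE (Hg i).2 ?s0B//; right.
Qed.

(** Near a point of the level b, G stays positive; near any other point of K, a small d makes the
    premise false. Compactness of K makes d uniform. *)
Lemma level_tube (Y : topologicalType) (K : set Y) (tau G : Y -> R) (b : R) :
  compact K -> continuous tau -> continuous G -> (forall x, K x -> tau x = b -> 0 < G x) ->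
  exists2 d, 0 < d & forall x, K x -> `|tau x - b| <= d -> 0 < G x.
Proof.
move=> Kc tc Gc KG.
pose P (d : R) (x : Y) := `|tau x - b| <= d -> 0 < G x.
have /compact_near_coveringP/(_ _ (0^'+) P) := Kc.
have H x : K x -> \forall x' \near x & d \near 0^'+, P d x'.
  move=> Kx; have [tb|tb] := eqVneq (tau x) b.
    have G0 := KG _ Kx tb.
    have /cvgr_gt/(_ _ G0) Gn := Gc x.
    exists ([set y | 0 < G y], setT); first split => //=; first exact: filterT.
    by move=> [y d] /= [Gy _] _.
  have nb : 0 < `|tau x - b| / 2 by rewrite divr_gt0// normr_gt0 subr_eq0.
  exists ([set y | `|tau x - b| / 2 < `|tau y - b|], [set d | d < `|tau x - b| / 2]); first split => /=.
  - have /cvgr_gt : (fun y => `|tau y - b|) y @[y --> x] --> `|tau x - b|.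
      by apply: cvg_norm; apply: cvgB; [exact: tc|exact: cvg_cst].
    by apply; rewrite ltr_pdivrMr// ltr_pMr ?ltr1n// normr_gt0 subr_eq0.
  - exact: nbhs_right_lt.
  - by move=> [y d] /= [t1 t2] t3; move: (lt_le_trans t1 t3); rewrite ltNge ltW.
move=> /(_ _ H); rewrite near_withinE => /nbhs_ballP[e /= e0 He].
exists (e / 2); first by rewrite divr_gt0.
move=> x Kx; apply: He => //; last by rewrite divr_gt0.
rewrite -ball_normE /= sub0r normrN ger0_norm ?divr_ge0 ?ltW//.
by rewrite ltr_pdivrMr// ltr_pMr ?ltr1n.
Qed.

Variable f : E -> E.
Hypothesis fc : continuous f.

(* Tietze's theorem for {x | 0 < <f x, v>}: r turns an extension into R^n of a
   partial map into an extension into the half-space preimage. *)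
Definition pushable := forall (v : E) (eps : R) (K : set E),
  v != 0 -> 0 < eps -> compact K -> exists r : E -> E,
  [/\ continuous r, forall x, eps <= dot (f x) v -> r x = x &
      forall x, K x -> 0 < dot (f (r x)) v].

Hypothesis fpush : pushable.

(** The push is applied after s. Its margin is the minimum of the positive function on the part over
    L, so that the values there do not move. *)
Lemma pos_selection_cst (Y : pseudoMetricType R) (K L : set Y) (v0 : E) (s : Y -> E) :
  compact K -> closed L -> continuous s -> v0 != 0 ->
  (forall x, K x -> L x -> 0 < dot (f (s x)) v0) ->
  exists s', [/\ continuous s', forall x, K x -> L x -> s' x = s x &
    forall x, K x -> 0 < dot (f (s' x)) v0].
Proof.
move=> Kc Lcl sc v0n sL.
have [eps eps0 Heps] : exists2 eps, 0 < eps & forall x, K x -> L x -> eps <= dot (f (s x)) v0.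
  have [[x1 [Kx1 Lx1]]|KL0] := pselect (exists x, (K `&` L) x); last first.
    by exists 1 => // x Kx Lx; case: KL0; exists x.
  have [|||x0] := @compact_EVT_min Y R (fun x => dot (f (s x)) v0) (K `&` L).
  - by exists x1.
  - exact: compact_closedI.
  - apply: continuous_subspaceT; apply: dot_cont; [exact: comp_cont|exact: cst_cont].
  rewrite inE => -[Kx0 Lx0] Hx0; exists (dot (f (s x0)) v0); first exact: sL.
  by move=> x Kx Lx; apply: Hx0; rewrite inE.
have [|r [rc rid rK]] := fpush (K := s @` K) v0n eps0.
  by apply: continuous_compact => //; exact: continuous_subspaceT.
exists (fun x => r (s x)); split.
- exact: comp_cont.
- by move=> x Kx Lx; apply/rid/Heps.
- by move=> x Kx; apply: rK; exists x.
Qed.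

(* Only the first m coordinates of v vary on K. On a level set of the last of
   them the induction hypothesis applies, and openness thickens its solution to
   a slab. Two slab solutions are matched along a level by applying the
   induction hypothesis once more, to K x [0, 1] over that level; completeness
   of R then carries the solution across K. *)
Lemma pos_selection_rec (m : nat) : (m <= n)%N ->
  forall (Y : pseudoMetricType R) (K L : set Y) (v s : Y -> E),
  compact K -> closed K -> closed L -> continuous v -> continuous s ->
  (forall x, K x -> v x != 0) ->
  (forall x y (i : 'I_n), K x -> K y -> (m <= i)%N -> v x 0 i = v y 0 i) ->
  (forall x, K x -> L x -> 0 < dot (f (s x)) (v x)) ->
  exists s', [/\ continuous s', forall x, K x -> L x -> s' x = s x &
    forall x, K x -> 0 < dot (f (s' x)) (v x)].
Proof.
elim: m => [|m IH] mn Y K L v s Kc Kcl Lcl vc sc vn0 vcst sL.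
  have [[x0 Kx0]|K0] := pselect (exists x, K x); last first.
    by exists s; split=> // x Kx; case: K0; exists x.
  have vE x : K x -> v x = v x0 by move=> Kx; apply/rowP => i; exact: vcst.
  have [|s' [s'c s's s'p]] := @pos_selection_cst Y K L (v x0) s Kc Lcl sc (vn0 _ Kx0).
    by move=> x Kx Lx; rewrite -(vE _ Kx); exact: sL.
  by exists s'; split=> // x Kx; rewrite vE//; exact: s'p.
pose i0 : 'I_n := Ordinal mn; pose tau x := v x 0 i0.
have tauc : continuous tau by exact: coord_cont.
pose pos F x := 0 < dot (f (F x)) (v x).
have posc (F : Y -> E) : continuous F -> continuous (fun x => dot (f (F x)) (v x)).
  by move=> Fc; apply: dot_cont => //; exact: comp_cont.
pose ext F := continuous F /\ forall x, K x -> L x -> F x = s x.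
have levcl b : closed [set x | tau x = b].
  by apply: (@closed_comp _ _ tau [set y | y = b]) => [x _|]; [exact: tauc|exact: closed_eq].
have slice_cst b x y (i : 'I_n) : K x -> K y -> tau x = b -> tau y = b -> (m <= i)%N -> v x 0 i = v y 0 i.
  move=> Kx Ky xb yb; rewrite leq_eqVlt => /orP[/eqP mi|]; last exact: vcst.
  have -> : i = i0 by apply/val_inj.
  by rewrite -/(tau x) -/(tau y) xb yb.
have Kb b : compact (K `&` [set x | tau x = b]) by apply: compact_closedI.
have local b : exists2 F, ext F & exists2 d, 0 < d & forall x, K x -> `|tau x - b| <= d -> pos F x.
  have [||x y i [Kx xb] [Ky yb]||s1 [s1c s1L s1p]] :=
      IH (ltnW mn) Y (K `&` [set x | tau x = b]) L v s (Kb b) _ Lcl vc sc.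
  - exact: closedI.
  - by move=> x [/vn0].
  - exact: slice_cst xb yb.
  - by move=> x [Kx _]; exact: sL.
  have [x [Kx Lx] [_ xb]|F [Fc FL Fb]] := continuous_glue (compact_closedI Kc Lcl)
     (closedI Kcl Lcl) (Kb b) (closedI Kcl (levcl b)) sc s1c.
    by rewrite s1L.
  exists F; first by split=> // x Kx Lx; exact: FL.
  apply: level_tube => //; first exact: posc.
  by move=> x Kx xb; rewrite Fb//; exact: s1p.
have glue (F G : Y -> E) b c : ext F -> ext G -> (forall x, K x -> tau x <= b -> pos F x) ->
    (forall x, K x -> b <= tau x -> tau x <= c -> pos G x) ->
    exists2 H, ext H & forall x, K x -> tau x <= c -> pos H x.
  move=> [Fc FL] [Gc GL] Fp Gp.
  have [cb|bc] := ltP c b.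
    by exists F => // x Kx xc; apply: Fp => //; exact: le_trans xc (ltW cb).
  (* The segment from F x to G x may leave the positive set. It is only the partial map to be
     corrected over the level b: its values are right at both ends and over L, that is, on L'. *)
  pose S (p : Y * R) := (1 - p.2) *: F p.1 + p.2 *: G p.1.
  have fstc : continuous (fst : Y * R -> Y) by move=> p; exact: cvg_fst.
  have sndc : continuous (snd : Y * R -> R) by move=> p; exact: cvg_snd.
  have Sc : continuous S.
    apply: add_cont; apply: scale_cont => //; try exact: comp_cont.
    by apply: sub_cont => //; exact: cst_cont.
  have S0 x : S (x, 0) = F x by rewrite /S /= subr0 scale1r scale0r addr0.
  have S1 x : S (x, 1) = G x by rewrite /S /= subrr scale1r scale0r add0r.
  have SL x t : K x -> L x -> S (x, t) = s x.
    by move=> Kx Lx; rewrite /S /= FL// GL// -scalerDl subrK scale1r.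
  pose I01 : set R := `[0, 1].
  pose K' := K `*` I01; pose Kb' := (K `&` [set x | tau x = b]) `*` I01.
  pose L' := [set p : Y * R | p.2 = 0] `|` [set p | p.2 = 1] `|` [set p | L p.1].
  have I01c : compact I01 by rewrite /I01; exact: segment_compact.
  have I01cl : closed I01 by exact: interval_closed.
  have closedX (A : set Y) : closed A -> closed (A `*` I01).
    move=> Acl; have -> : A `*` I01 = (fst @^-1` A) `&` (snd @^-1` I01) by [].
    by apply: closedI; apply: closed_comp => // p _; solve [exact: fstc | exact: sndc].
  have L'cl : closed L'.
    apply: closedU; first apply: closedU.
    - by apply: (@closed_comp _ _ snd [set y : R | y = 0]) => [p _|]; [exact: sndc|exact: closed_eq].
    - by apply: (@closed_comp _ _ snd [set y : R | y = 1]) => [p _|]; [exact: sndc|exact: closed_eq].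
    - by apply: (@closed_comp _ _ fst L) => // p _; exact: fstc.
  have Kb'c : compact Kb' by apply: compact_setX.
  have Kb'cl : closed Kb' by apply: closedX; apply: closedI.
  have [|||||p [[Kx xb] _]|p q i [[Kx xb] _] [[Ky yb] _]|p|H [Hc HL Hp]] :=
    IH (ltnW mn) (Y * R)%type Kb' L' (v \o fst) S => //.
  - exact: comp_cont.
  - exact: vn0.
  - exact: slice_cst xb yb.
  - case: p => x t [[/= Kx xb] _] [[/= ->|/= ->]|/= Lx].
    + by rewrite S0; apply: Fp; rewrite ?xb.
    + by rewrite S1; apply: Gp; rewrite ?xb.
    + by rewrite SL//; exact: sL.
  (* H is controlled only over the level b; after gluing, H' also equals S on L' over the rest of K,
     hence F and G at the two ends. *)
  have [||||||p|H' [H'c H'L H'b]] := @continuous_glue (Y * R)%type (K' `&` L') Kb' S H => //.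
  - by apply: compact_closedI => //; exact: compact_setX.
  - by apply: closedI => //; exact: closedX.
  - by move=> [_ L'p] Kb'p; rewrite HL.
  have [||||d d0 Hd] := @level_tube (Y * R)%type K' (tau \o fst) (fun p => dot (f (H' p)) (v p.1)) b.
  - exact: compact_setX.
  - exact: comp_cont.
  - by apply: dot_cont; exact: comp_cont.
  - by move=> p [Kp Ip] /= pb; rewrite H'b; [apply: Hp|].
  (* The homotopy time as a function of the level: 0 up to b, 1 from b + d on. Thus x |-> H' (x, cl
     x) is F below the slab and G above it. *)
  pose cl x := Num.max 0 (Num.min 1 ((tau x - b) / d)).
  have clc : continuous cl.
    apply: max_cont; first exact: cst_cont.
    apply: min_cont; first exact: cst_cont.
    by apply: mul_cont; [apply: sub_cont => //|]; exact: cst_cont.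
  have cl01 x : I01 (cl x).
    by rewrite /I01 /= in_itv /= /cl le_max lexx /= ge_max ler01 ge_min lexx.
  have graphc : continuous (fun x => (x, cl x)).
    by move=> x; apply: (@cvg_pair _ _ _ _ (nbhs x) (nbhs (cl x))); [exact: cvg_id|exact: clc].
  exists (fun x => H' (x, cl x)).
    split; first exact: (comp_cont graphc).
    move=> x Kx Lx; rewrite H'L ?SL//; split; first by split=> /=; [|exact: cl01].
    by right.
  move=> x Kx xc; rewrite /pos.
  have [xb|bx] := leP (tau x) b.
    have cl0 : cl x = 0.
      rewrite /cl; apply: max_l; rewrite ge_min; apply/orP; right.
      by rewrite pmulr_lle0 ?invr_gt0// subr_le0.
    rewrite cl0 H'L ?S0; first exact: Fp.
    by split; [split=> //=; rewrite -cl0; exact: cl01|left; left].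
  have [xd|dx] := leP (tau x) (b + d).
    apply: (Hd (x, cl x)); first by split=> //=; exact: cl01.
    by rewrite /= ler_norml; apply/andP; split; lra.
  have cl1 : cl x = 1.
    rewrite /cl min_l ?max_r//.
    by rewrite ler_pdivlMr// mul1r; lra.
  rewrite cl1 H'L ?S1; first by apply: Gp => //; exact: ltW.
  by split; [split=> //=; rewrite -cl1; exact: cl01|left; right].
pose good b := exists2 F, ext F & forall x, K x -> tau x <= b -> pos F x.
have [M M0 HM] : exists2 M, 0 < M & forall x, K x -> `|tau x| <= M.
  have [|M M0 HM] := @compact_norm_le R n (v @` K).
    by apply: continuous_compact => //; exact: continuous_subspaceT.
  exists M => // x Kx; apply: le_trans (coord_le_norm _ _ _) (HM _ _); by exists x.
suff [F [Fc FL] Fp] : good M.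
  by exists F; split=> // x Kx; apply: Fp => //; exact: le_trans (ler_norm _) (HM _ Kx).
apply: contrapT => ngood.
have goodM b : good b -> b <= M.
  move=> [F Fe Fp]; rewrite leNgt; apply/negP => Mb; apply: ngood; exists F => // x Kx xM.
  by apply: Fp => //; exact: le_trans xM (ltW Mb).
have hs : has_sup good.
  split; last by exists M.
  (* No point of K lies at or below this level, so s itself serves. *)
  exists (- M - 1), s => // x Kx xM; have := HM _ Kx; rewrite ler_norml => /andP[+ _].
  lra.
have [G Ge [d d0 Gp]] := local (sup good).
have [b [F Fe Fp] bs] := sup_adherent d0 hs.
have bsup : b <= sup good by apply: sup_upper_bound => //; exists F.
(* As b > sup good - d, the map G is positive on the levels from b to sup good + d, and continuing F
   by G passes the supremum. *)
suff : good (sup good + d) by move=> /(sup_upper_bound hs); rewrite gerDl leNgt d0.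
apply: glue Fe Ge Fp _ => x Kx bx xd; apply: Gp => //.
by rewrite ler_norml; apply/andP; split; lra.
Qed.

Theorem pos_selection (Y : pseudoMetricType R) (K L : set Y) (v s : Y -> E) :
  compact K -> closed K -> closed L -> continuous v -> continuous s ->
  (forall x, K x -> v x != 0) ->
  (forall x, K x -> L x -> 0 < dot (f (s x)) (v x)) ->
  exists s', [/\ continuous s', forall x, K x -> L x -> s' x = s x &
    forall x, K x -> 0 < dot (f (s' x)) (v x)].
Proof.
move=> Kc Kcl Lcl vc sc vn0 sL; apply: (pos_selection_rec (leqnn n)) => //.
by move=> x y i _ _; rewrite leqNgt ltn_ord.
Qed.

End Selection.

(** * Lengths of curves and polygons *)

Section CurveLength.
Context {R : realType} {n : nat}.
Local Notation E := 'rV[R]_n.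
Variable g : E -> 'M[R]_n.

Lemma metric_formE x u w :
  metric_form g x u w = \sum_(j < n) (\sum_(i < n) u 0 i * g x i j) * w 0 j.
Proof. by rewrite /metric_form !mxE; apply: eq_bigr => j _; rewrite !mxE. Qed.

Lemma metric_formZ x a b u w : metric_form g x (a *: u) (b *: w) = a * b * metric_form g x u w.
Proof.
by rewrite /metric_form linearZ /= -!scalemxAl -scalemxAr !mxE mulrA.
Qed.

Lemma metric_norm_ge0 x u : 0 <= metric_norm g x u.
Proof. exact: sqrtr_ge0. Qed.

Lemma metric_normZ x a u : metric_norm g x (a *: u) = `|a| * metric_norm g x u.
Proof. by rewrite /metric_norm metric_formZ -expr2 sqrtrM ?sqr_ge0// sqrtr_sqr. Qed.

Lemma metric_norm0 x : metric_norm g x 0 = 0.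
Proof. by rewrite -(scale0r 0) metric_normZ normr0 mul0r. Qed.

Hypothesis g_cont : continuous g.

Lemma metric_form_cont {T : topologicalType} (p u w : T -> E) :
  continuous p -> continuous u -> continuous w ->
  continuous (fun t => metric_form g (p t) (u t) (w t)).
Proof.
move=> pc uc wc; under eq_fun do rewrite metric_formE.
apply: sum_cont => j; apply: mul_cont; last exact: coord_cont.
apply: sum_cont => i; apply: mul_cont; first exact: coord_cont.
by apply: coord_cont; exact: comp_cont.
Qed.

Lemma metric_norm_cont {T : topologicalType} (p u : T -> E) :
  continuous p -> continuous u -> continuous (fun t => metric_norm g (p t) (u t)).
Proof.
move=> pc uc; apply: comp_cont; first exact: metric_form_cont.
exact: sqrt_continuous.
Qed.

Variable c : R -> E.
Let phi t := metric_norm g (c t) (derive1 c t).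

(* DN is the differential of N, and |dN| <= 1 for the dual norm of g: the
   length of a curve is then at least the increase of N along it. *)
Definition C1_calibration (N : E -> R) (DN : E -> E -> R) :=
  [/\ forall (e : R -> E) t, differentiable e t -> is_derive t 1 (N \o e) (DN (e t) ('d e t 1)),
      forall u w : R -> E, continuous u -> continuous w -> continuous (fun t => DN (u t) (w t)) &
      forall x w, DN x w <= metric_norm g x w].

Local Notation mu := (@lebesgue_measure R).

(** The derivatives of c and e agree only in the open interval, but the end points are negligible.
    The lower bound is the fundamental theorem of calculus for N along e. Finiteness is recorded
    because [curve_length] is the real part of an extended integral, which would turn an infinite
    value into 0. *)
Lemma piece_integral (N : E -> R) DN a b e : C1_calibration N DN -> a < b ->
  Ck_on 1 setT e -> {in `[a, b], c =1 e} ->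
  [/\ measurable_fun `[a, b] phi,
      (\int[mu]_(t in `[a, b]) (phi t)%:E < +oo)%E,
      ((N (c b) - N (c a))%:E <= \int[mu]_(t in `[a, b]) (phi t)%:E)%E &
      forall C, (forall t, a < t < b -> phi t <= C) ->
      (\int[mu]_(t in `[a, b]) (phi t)%:E <= (C * (b - a))%:E)%E].
Proof.
move=> [Nder Ncont Nle] ab [ediff econt] ce.
have ed t : differentiable e t by exact: ediff.
have ec : continuous e by move=> t; exact: differentiable_continuous.
have dec : continuous (fun t => 'd e t 1) by move=> t; exact: econt.
pose psi t := metric_norm g (e t) ('d e t 1).
have psic : continuous psi by exact: metric_norm_cont.
have oocc t : t \in `]a, b[ -> t \in `[a, b].
  by rewrite !in_itv/= => /andP[/ltW -> /ltW ->].
have phipsi : {in `]a, b[, phi =1 psi}.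
  move=> t tab; rewrite /phi /psi ce; last exact: oocc.
  have dce : \near t, c t = e t.
    by apply: filterS (near_in_itvoo tab) => z /oocc; exact: ce.
  congr metric_norm; rewrite derive1E (near_eq_derive _ dce); exact: deriveE.
have mpsi (D : set R) : measurable_fun D psi.
  exact: measurable_funS (continuous_measurable_fun psic).
have mphi_oo : measurable_fun `]a, b[ phi.
  by apply: eq_measurable_fun (mpsi _) => t; rewrite inE => /phipsi.
have mphi : measurable_fun `[a, b] phi by apply: measurable_fun_itv_cc mphi_oo.
have phiE : (\int[mu]_(t in `[a, b]) (phi t)%:E = \int[mu]_(t in `[a, b]) (psi t)%:E)%E.
  exact: eq_integral_itv_bounded.
have ipsi : mu.-integrable `[a, b] (EFin \o psi).
  by apply: continuous_compact_integrable; [exact: segment_compact|exact: continuous_subspaceT].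
split=> //.
- by rewrite phiE; exact: integrable_lty ipsi.
- have uc : continuous (fun t => DN (e t) ('d e t 1)) by exact: Ncont.
  have Nd (t : R) : is_derive t 1 (N \o e) (DN (e t) ('d e t 1)) by exact: Nder.
  have Nec : continuous (N \o e).
    by move=> t; apply: differentiable_continuous; apply/derivable1_diffP; case: (Nd t).
  have cb : c b = e b by apply: ce; rewrite in_itv/= lexx ltW.
  have ca : c a = e a by apply: ce; rewrite in_itv/= lexx ltW.
  rewrite cb ca EFinB -(@continuous_FTC2 R (fun t : R => DN (e t) ('d e t 1)) (N \o e) a b ab).
  + rewrite phiE; apply: le_integral => //.
    * by apply: continuous_compact_integrable; [exact: segment_compact|exact: continuous_subspaceT].
    * by move=> t _; rewrite lee_fin Nle.
  + exact: continuous_subspaceT.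
  + split=> [t _||]; first by case: (Nd t).
      by apply: cvg_at_right_filter; exact: Nec.
    by apply: cvg_at_left_filter; exact: Nec.
  + by move=> t _; rewrite derive1E; case: (Nd t).
- move=> C phiC; rewrite integral_itv_bndoo; last exact/measurable_EFinP.
  have -> : (C * (b - a))%:E = (\int[mu]_(t in `]a, b[) (cst C%:E) t)%E.
    by rewrite integral_cst//= lebesgue_measure_itv/= lte_fin ab EFinM EFinB.
  apply: ge0_le_integral => //.
  + by move=> t _; rewrite lee_fin metric_norm_ge0.
  + exact/measurable_EFinP.
Qed.

Lemma pieces_integral (N : E -> R) DN (s : seq R) a : C1_calibration N DN ->
  path <%R a s ->
  (forall i, (i < size s)%N -> exists e : R -> E, Ck_on 1 setT e /\
     {in `[nth 0 (a :: s) i, nth 0 s i], c =1 e}) ->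
  let b := last a s in
  [/\ a <= b, measurable_fun `[a, b] phi,
      (\int[mu]_(t in `[a, b]) (phi t)%:E < +oo)%E,
      ((N (c b) - N (c a))%:E <= \int[mu]_(t in `[a, b]) (phi t)%:E)%E &
      forall C, (forall t, a < t < b -> t \notin s -> phi t <= C) ->
      (\int[mu]_(t in `[a, b]) (phi t)%:E <= (C * (b - a))%:E)%E].
Proof.
move=> cal; elim: s a => [|x s IH] a /=.
  move=> _ _; split=> //.
  - by rewrite set_itv1; exact: measurable_fun_set1.
  - by rewrite set_itv1 integral_set1.
  - by rewrite subrr set_itv1 integral_set1.
  - by move=> C _; rewrite subrr mulr0 set_itv1 integral_set1.
move=> /andP[ax xs] pcs; set b := last x s.
have [xb mb fb lb ub] : [/\ x <= b, measurable_fun `[x, b] phi,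
      (\int[mu]_(t in `[x, b]) (phi t)%:E < +oo)%E,
      ((N (c b) - N (c x))%:E <= \int[mu]_(t in `[x, b]) (phi t)%:E)%E &
      forall C, (forall t, x < t < b -> t \notin s -> phi t <= C) ->
      (\int[mu]_(t in `[x, b]) (phi t)%:E <= (C * (b - x))%:E)%E].
  by apply: IH => // i si; exact: (pcs i.+1).
have [e [eC1 ce]] := pcs 0%N isT.
have [ma fa la ua] := piece_integral cal ax eC1 ce.
have ma' : measurable_fun `[a, x[ phi by exact: measurable_fun_itv_co ma.
have abE : (`[a, b] = `[a, x[ `|` `[x, b] :> set R)%classic.
  by apply: itv_bndbnd_setU; rewrite bnd_simp// ltW.
have intE : (\int[mu]_(t in `[a, b]) (phi t)%:E =
    \int[mu]_(t in `[a, x]) (phi t)%:E + \int[mu]_(t in `[x, b]) (phi t)%:E)%E.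
  rewrite abE ge0_integral_setU//=.
  - by rewrite integral_itv_bndo_bndc//; exact/measurable_EFinP.
  - by apply/measurable_EFinP/measurable_funU => //; split.
  - by move=> t _; rewrite lee_fin metric_norm_ge0.
  - apply/disj_setPLR => t /=; rewrite !in_itv/= => /andP[_ tx].
    by rewrite leNgt tx.
split.
- exact: le_trans (ltW ax) xb.
- by rewrite abE; apply/measurable_funU => //; split.
- by rewrite intE lte_add_pinfty.
- rewrite intE (_ : _ - _ = (N (c x) - N (c a)) + (N (c b) - N (c x))); last by ring.
  by rewrite EFinD leeD.
- move=> C phiC; rewrite intE (_ : C * _ = C * (x - a) + C * (b - x)); last by ring.
  rewrite EFinD leeD//; [apply: ua|apply: ub] => t /andP[t1 t2].
    apply: phiC; first by rewrite t1 (lt_le_trans t2).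
    rewrite inE negb_or lt_eqF//=; apply/negP => ts.
    have := order_path_min lt_trans xs => /allP/(_ _ ts).
    by rewrite ltNge ltW.
  move=> ts; apply: phiC; first by rewrite t2 (lt_trans ax).
  by rewrite inE negb_or gt_eqF.
Qed.

Lemma curve_length_ge (N : E -> R) DN : C1_calibration N DN -> piecewise_C1 c ->
  N (c 1) - N (c 0) <= curve_length g c.
Proof.
move=> cal [s [s0 s1 pcs]].
have [_ _ fin low _] := pieces_integral cal s0 pcs.
rewrite s1 in fin low; rewrite /curve_length /Rintegral -lee_fin fineK//.
rewrite ge0_fin_numE// integral_ge0// => t _; by rewrite lee_fin metric_norm_ge0.
Qed.

Lemma curve_length_le C (s : seq R) : path <%R 0 s -> last 0 s = 1 ->
  (forall i, (i < size s)%N -> exists e : R -> E, Ck_on 1 setT e /\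
     {in `[nth 0 (0 :: s) i, nth 0 s i], c =1 e}) ->
  (forall t, 0 < t < 1 -> t \notin s -> phi t <= C) ->
  curve_length g c <= C.
Proof.
move=> s0 s1 pcs phiC.
(* A trivial calibration, since only the upper bound of [pieces_integral] is wanted. *)
have cal : C1_calibration (fun=> 0) (fun _ _ => 0).
  split.
  - by move=> e t _; exact: is_derive_cst.
  - by move=> u w _ _; exact: cst_cont.
  - by move=> x w; exact: metric_norm_ge0.
have [_ _ fin _ up] := pieces_integral cal s0 pcs.
rewrite s1 in fin up; have := up C phiC; rewrite subr0 mulr1.
rewrite /curve_length /Rintegral -lee_fin fineK//.
rewrite ge0_fin_numE// integral_ge0// => t _; by rewrite lee_fin metric_norm_ge0.
Qed.

End CurveLength.

(** * Polygons and the Riemannian distance *)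

Section Polygons.
Context {R : realType} {n : nat}.
Local Notation E := 'rV[R]_n.
Variable g : E -> 'M[R]_n.

(* Edges are weighted by an upper bound l of their length, so that lengths of
   polygons never have to be computed. *)
Definition seg x y l := 0 < l /\
  forall t, 0 <= t <= 1 -> metric_norm g (x + t *: (y - x)) (y - x) <= l.

Inductive reach (x : E) : R -> E -> Prop :=
| reach_seg y l : seg x y l -> reach x l y
| reach_step L y l z : reach x L y -> seg y z l -> reach x (L + l) z.

Lemma seg_sym x y l : seg x y l -> seg y x l.
Proof.
move=> [l0 H]; split=> // t /andP[t0 t1].
have -> : y + t *: (x - y) = x + (1 - t) *: (y - x).
  by apply/rowP => i; rewrite !mxE; ring.
have -> : x - y = (-1) *: (y - x) by rewrite scaleN1r opprB.
by rewrite metric_normZ normrN1 mul1r; apply: H; apply/andP; split; lra.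
Qed.

Lemma seg_le x y l l' : l <= l' -> seg x y l -> seg x y l'.
Proof.
move=> ll [l0 H]; split; first exact: lt_le_trans ll.
by move=> t /H; move/le_trans; apply.
Qed.

Lemma seg_split x y l a : 0 < a < l -> seg x y l ->
  exists m, seg x m a /\ seg m y (l - a).
Proof.
move=> /andP[a0 al] [l0 H]; pose th := a / l.
have th0 : 0 < th by rewrite divr_gt0.
have th1 : th < 1 by rewrite ltr_pdivrMr// mul1r.
exists (x + th *: (y - x)); split; split=> //; try by rewrite subr_gt0.
  move=> t /andP[t0 t1]; have -> : x + th *: (y - x) - x = th *: (y - x) by rewrite addrAC subrr add0r.
  rewrite scalerA metric_normZ gtr0_norm// -[leRHS](divfK (lt0r_neq0 l0)) -/th ler_pM2l//.
  apply: H; apply/andP; split; first by rewrite mulr_ge0// ltW.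
  by apply: mulr_ile1 => //; exact: ltW.
move=> t /andP[t0 t1].
have -> : y - (x + th *: (y - x)) = (1 - th) *: (y - x) by apply/rowP => i; rewrite !mxE; ring.
have -> : x + th *: (y - x) + t *: ((1 - th) *: (y - x)) = x + (th + t * (1 - th)) *: (y - x).
  by rewrite scalerA scalerDl addrA.
rewrite metric_normZ ger0_norm; last by rewrite subr_ge0 ltW.
have -> : l - a = (1 - th) * l by rewrite mulrBl mul1r divfK// gt_eqF.
rewrite ler_pM2l ?subr_gt0//; apply: H.
have t1' : 0 <= 1 - t by lra.
have h1 : 0 <= t * (1 - th) by rewrite mulr_ge0// subr_ge0 ltW.
have h2 : 0 <= (1 - t) * (1 - th) by rewrite mulr_ge0// subr_ge0 ltW.
apply/andP; split; first by rewrite addr_ge0// ltW.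
by move: h2; rewrite mulrBl mul1r; lra.
Qed.

Lemma reach_gt0 x L y : reach x L y -> 0 < L.
Proof. by elim=> [z l []//|L' z l w _ L0 [l0 _]]; rewrite addr_gt0. Qed.

Lemma reach_le x L y L' : L <= L' -> reach x L y -> reach x L' y.
Proof.
move=> LL H; case: H LL => [z l sxz LL|L0 z l w rxz szw LL].
  by apply: reach_seg; exact: seg_le sxz.
rewrite -(subrK L0 L') addrC; apply: (reach_step rxz); apply: seg_le szw; lra.
Qed.

Lemma reach_trans x L y L' z : reach x L y -> reach y L' z -> reach x (L + L') z.
Proof.
move=> rxy; elim=> [w l syw|L0 w l w' _ IH sww']; first exact: reach_step rxy syw.
by rewrite addrA; exact: reach_step IH sww'.
Qed.

Lemma reach_sym x L y : reach x L y -> reach y L x.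
Proof.
elim=> [w l syw|L0 w l w' _ IH sww']; first by apply: reach_seg; exact: seg_sym.
by rewrite addrC; apply: reach_trans IH; apply: reach_seg; exact: seg_sym.
Qed.

Lemma reach_split x L y a : reach x L y -> 0 < a < L ->
  exists m, reach x a m /\ reach m (L - a) y.
Proof.
move=> rxy; elim: rxy a => [w l sxw a al|L0 w l w' rxw IH sww' a /andP[a0 aL]].
  have [m [sxm smw]] := seg_split al sxw.
  by exists m; split; exact: reach_seg.
have [aL0|L0a|aL0] := ltgtP a L0.
- have [|m [rxm rmw]] := IH a; first by rewrite a0.
  by exists m; split=> //; rewrite addrAC; exact: reach_step rmw sww'.
- have [|m [swm smw']] := seg_split (a := a - L0) _ sww'; first by apply/andP; split; lra.
  exists m; split; first by rewrite -(subrK L0 a) addrC; exact: reach_step rxw swm.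
  by apply: reach_seg; rewrite (_ : _ - a = l - (a - L0))//; ring.
- exists w; split; first by rewrite aL0.
  by apply: reach_seg; rewrite aL0 addrAC subrr add0r.
Qed.

Lemma path_nth_le (s : seq R) a i : path <%R a s -> (i < size s)%N ->
  a < nth 0 s i /\ nth 0 s i <= last a s.
Proof.
elim: s a i => [//|b s IH] a [|i] /= /andP[ab bs] si.
  split=> //; case: s bs IH {si} => [//|c s] bs IH.
  have [bc cl] := IH b 0%N bs isT; exact: ltW (lt_le_trans bc cl).
by have [bi il] := IH b i bs si; split=> //; exact: lt_trans bi.
Qed.

Lemma path_piece (s : seq R) a t : path <%R a s -> a < t -> t < last a s -> t \notin s ->
  exists2 i, (i < size s)%N & nth 0 (a :: s) i < t < nth 0 s i.
Proof.
elim: s a => [|b s IH] a /=; first by move=> _ at1 /(lt_trans at1); rewrite ltxx.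
move=> /andP[ab bs] at1 tl; rewrite inE negb_or => /andP[tb ts].
have [tb'|bt|tbE] := ltgtP t b; last by rewrite tbE eqxx in tb.
  by exists 0%N => //=; rewrite at1.
by have [i si it] := IH b bs bt tl ts; exists i.+1.
Qed.

(* Spending time l on an edge of weight l gives a parametrization of speed at
   most 1 by [0, L]. *)
Lemma reach_polygon x L y : reach x L y -> exists (s : seq R) (c : R -> E),
  [/\ path <%R 0 s, last 0 s = L, c 0 = x, c L = y &
   forall i, (i < size s)%N -> exists p w : E,
     forall t, nth 0 (0 :: s) i <= t <= nth 0 s i ->
       c t = p + t *: w /\ metric_norm g (c t) w <= 1].
Proof.
elim=> [z l [l0 sxz]|L0 z l w rxz [s [c [s0 sl c0 cL cp]]] [l0 szw]].
  exists [:: l], (fun t => x + (t / l) *: (z - x)); split=> //=.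
  - by rewrite l0.
  - by rewrite mul0r scale0r addr0.
  - by rewrite divff ?gt_eqF// scale1r addrC subrK.
  - move=> [|//] _; exists x, (l^-1 *: (z - x)) => t /= /andP[t0 tl].
    split; first by rewrite scalerA.
    rewrite metric_normZ gtr0_norm ?invr_gt0// mulrC ler_pdivrMr// mul1r.
    by apply: sxz; rewrite ler_pdivrMr// mul1r tl andbT divr_ge0// ltW.
have L00 := reach_gt0 rxz.
exists (rcons s (L0 + l)), (fun t => if t <= L0 then c t else z + ((t - L0) / l) *: (w - z)).
have llt : L0 < L0 + l by rewrite ltrDl.
split.
- by rewrite rcons_path s0 sl.
- by rewrite last_rcons.
- by rewrite ltW.
- by rewrite leNgt llt /= addrAC subrr add0r divff ?gt_eqF// scale1r addrC subrK.
move=> i; rewrite size_rcons ltnS leq_eqVlt => /orP[/eqP ->|si].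
  exists (z - (L0 / l) *: (w - z)), (l^-1 *: (w - z)) => t.
  rewrite -rcons_cons nth_rcons [size (_ :: _)]/= ltnSn nth_rcons ltnn eqxx.
  have -> : nth 0 (0 :: s) (size s) = L0 by rewrite -sl (last_nth 0).
  move=> /andP[t1 t2].
  have cE : (if t <= L0 then c t else z + ((t - L0) / l) *: (w - z)) = z + ((t - L0) / l) *: (w - z).
    case: ifP => // t3; have -> : t = L0 by apply/eqP; rewrite eq_le t3.
    by rewrite subrr mul0r scale0r addr0.
  rewrite cE; split; first by apply/rowP => j; rewrite !mxE; ring.
  rewrite metric_normZ gtr0_norm ?invr_gt0// mulrC ler_pdivrMr// mul1r.
  by apply: szw; rewrite ler_pdivrMr// mul1r lerBlDl t2 andbT divr_ge0 ?subr_ge0// ltW.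
have [p [v pv]] := cp i si; exists p, v => t.
have -> : nth 0 (0 :: rcons s (L0 + l)) i = nth 0 (0 :: s) i.
  by rewrite -rcons_cons nth_rcons /= ltnS ltnW.
rewrite nth_rcons si => /[dup] /andP[_ t2] /pv.
rewrite ifT//; apply: le_trans t2 _; rewrite -sl.
by have [] := path_nth_le s0 si.
Qed.

Hypothesis g_cont : continuous g.

Lemma is_diff_affine (p w : E) (t : R) :
  is_diff t (fun t : R => p + t *: w) (fun t => t *: w).
Proof.
have H := is_diffD (is_diff_cst p t) (is_diff_scalel t w).
apply: (is_diff_eq H); apply/funext => u /=; exact: add0r.
Qed.

Lemma affine_C1 (p w : E) : Ck_on 1 setT (fun t : R => p + t *: w).
Proof.
split=> [t _|v t _]; first by case: (is_diff_affine p w t).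
have -> : (fun t => 'd (fun t : R => p + t *: w) t v) = fun=> v *: w.
  by apply/funext => t'; case: (is_diff_affine p w t') => _ ->.
exact: cst_cont.
Qed.

Lemma reach_curve x L y : reach x L y -> exists c : R -> E,
  [/\ piecewise_C1 c, c 0 = x, c 1 = y & curve_length g c <= L].
Proof.
move=> /[dup] /reach_gt0 L0 /reach_polygon[s [c [s0 sl c0 cL cp]]].
(* Rescaling time from [0, L] to [0, 1] turns speed at most 1 into speed at most L. *)
pose s' := map (fun t => t / L) s; pose c' t := c (L * t).
have nths i : (i < size s)%N -> nth 0 s' i = nth 0 s i / L by move=> si; rewrite (nth_map 0).
have nth0s i : (i < size s)%N -> nth 0 (0 :: s') i = nth 0 (0 :: s) i / L.
  by case: i => [|i] si /=; rewrite ?mul0r// nths// ltnW.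
have s'0 : path <%R 0 s'.
  have := @path_map _ _ (fun t => t / L) <%R 0 s; rewrite /= mul0r => ->; apply: sub_path s0 => a b /= ab.
  by rewrite ltr_pM2r ?invr_gt0.
have s'1 : last 0 s' = 1.
  have := last_map (fun t => t / L) s 0; rewrite /= mul0r => ->.
  by rewrite sl divff// gt_eqF.
have pcs i : (i < size s')%N -> exists p w : E, forall t,
    nth 0 (0 :: s') i <= t <= nth 0 s' i -> c' t = p + t *: w /\ metric_norm g (c' t) w <= L.
  rewrite size_map => si; have [p [w pw]] := cp i si.
  exists p, (L *: w) => t; rewrite nth0s// nths// ler_pdivrMr// ler_pdivlMr// mulrC => tL.
  have [cE nw] := pw _ tL; split; first by rewrite /c' cE scalerA mulrC.
  by rewrite metric_normZ gtr0_norm// -[leRHS]mulr1 ler_pM2l.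
have pcs' i : (i < size s')%N -> exists e : R -> E, Ck_on 1 setT e /\
     {in `[nth 0 (0 :: s') i, nth 0 s' i], c' =1 e}.
  move=> si; have [p [w pw]] := pcs i si.
  exists (fun t => p + t *: w); split; first exact: affine_C1.
  by move=> t; rewrite in_itv/= => /pw[].
exists c'; split.
- by exists s'.
- by rewrite /c' mulr0.
- by rewrite /c' mulr1.
apply: (curve_length_le g_cont (s := s')) => // t /andP[t0 t1] ts.
have [|i si it] := path_piece s'0 t0 _ ts; first by rewrite s'1.
have [p [w pw]] := pcs i si.
have itt u : nth 0 (0 :: s') i < u < nth 0 s' i -> nth 0 (0 :: s') i <= u <= nth 0 s' i.
  by move=> /andP[/ltW -> /ltW ->].
suff -> : derive1 c' t = w by have [] := pw t (itt t it).
have [ed dv] := is_diff_affine p w t.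
rewrite derive1E (near_eq_derive (g := fun t : R => p + t *: w)).
  by rewrite deriveE// dv scale1r.
have ti : t \in `]nth 0 (0 :: s') i, nth 0 s' i[ by rewrite in_itv.
by apply: filterS (near_in_itvoo ti) => u; rewrite in_itv => /itt /pw[].
Qed.

Lemma curve_length_ge0 c : 0 <= curve_length g c.
Proof. by apply: Rintegral_ge0 => t _; exact: metric_norm_ge0. Qed.

Lemma reach_dist x L y : reach x L y -> riemannian_dist g x y <= L.
Proof.
move=> /reach_curve[c [cC c0 c1 cL]]; apply: le_trans cL.
apply: ge_inf; last by exists c; split.
by exists 0 => l [c' [_ _ _ ->]]; exact: curve_length_ge0.
Qed.

Lemma calibration_dist (N : E -> R) DN x y : C1_calibration g N DN ->
  N y - N x <= riemannian_dist g x y.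
Proof.
move=> cal; apply: lb_le_inf.
  (* The straight segment shows that the set of lengths is nonempty, so that its infimum is
     meaningful. *)
  have [l sl] : exists l, seg x y l.
    have Mc : continuous (fun t : R => metric_norm g (x + t *: (y - x)) (y - x)).
      apply: metric_norm_cont => //; last exact: cst_cont.
      apply: add_cont; first exact: cst_cont.
      by apply: scale_cont; [exact: id_cont|exact: cst_cont].
    have [|t _ Ht] := @EVT_max R (fun t : R => metric_norm g (x + t *: (y - x)) (y - x)) 0 1 ler01.
      exact: continuous_subspaceT.
    exists (metric_norm g (x + t *: (y - x)) (y - x) + 1); split.
      by rewrite ltr_wpDl// metric_norm_ge0.
    by move=> u u01; rewrite (le_trans (Ht u _)) ?in_itv// lerDl.
  have [c [cC c0 c1 _]] := reach_curve (reach_seg sl).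
  by exists (curve_length g c), c.
by move=> l [c [cC <- <- ->]]; apply: (curve_length_ge g_cont cal cC).
Qed.

(** At m = p the speed is 0 for every t, and compactness of [0, 1] makes continuity in m uniform in
    t. *)
Lemma seg_near p eps : 0 < eps -> \forall m \near p, seg p m eps.
Proof.
move=> e0.
pose P (m : E) (t : R) := metric_norm g (p + t *: (m - p)) (m - p) < eps.
have /compact_near_coveringP/(_ _ (nbhs p) P _) H := @segment_compact R 0 1.
have Fc : continuous (fun tm : R * E => metric_norm g (p + tm.1 *: (tm.2 - p)) (tm.2 - p)).
  have c1 : continuous (fun tm : R * E => tm.2 - p).
    by apply: sub_cont; [move=> z; exact: cvg_snd|exact: cst_cont].
  apply: metric_norm_cont => //; apply: add_cont; first exact: cst_cont.
  by apply: scale_cont => // z; exact: cvg_fst.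
have : \forall m \near p, `[0, 1]%classic `<=` P m.
  apply: H => t _; have /cvgr_lt := Fc (t, p).
  by apply; rewrite /= subrr metric_norm0.
by apply: filterS => m Pm; split=> // t t01; apply: ltW; apply: Pm; rewrite /= in_itv.
Qed.

End Polygons.

(** * Boundedness of the points reachable with bounded length *)

Section Bump.
Context {R : realType} {n : nat}.
Local Notation E := 'rV[R]_n.

Lemma is_derive_coord (e : R -> E) (t : R) i : differentiable e t ->
  is_derive t 1 (fun t => e t 0 i) ('d e t 1 0 i).
Proof.
move=> ed.
have @f : {linear E -> R}.
  by exists (fun N : E => N 0 i); do 2![eexists]; do ?[constructor];
     rewrite ?mxE// => ? *; rewrite ?mxE//; move=> ?; rewrite !mxE.
have fc : continuous f by exact: coord_continuous.
have fd x : differentiable f x by exact: linear_differentiable.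
have cd : differentiable (f \o e) t by exact: differentiable_comp.
apply: DeriveDef; first exact/derivable1_diffP.
by rewrite (deriveE _ cd) diff_comp// diff_lin.
Qed.

(** Squaring makes the truncation C^1 at 0, as a calibration requires. *)
Definition sqpos (x : R) := Num.max 0 x ^+ 2.

Lemma is_derive_sqpos (x : R) : is_derive x 1 sqpos (2 * Num.max 0 x).
Proof.
have [x0|x0|->] := ltgtP x 0.
- rewrite mulr0.
  apply: (@near_eq_is_derive _ _ _ (cst 0)).
  near=> y; have y0 : y < 0 by near: y; exact: (cvgr_lt x).
  by rewrite /sqpos max_l ?expr0n// ltW.
- have sq : is_derive x 1 (fun y : R => y ^+ 2) (2 * x).
    have := @is_deriveX R R id 2 x 1 1 (is_derive_id _ _).
    by move=> H; apply: is_derive_eq; rewrite /= expr1 [LHS]mulr1.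
  apply: near_eq_is_derive sq.
  near=> y; have y0 : 0 < y by near: y; exact: (cvgr_gt x).
  by rewrite /sqpos max_r// ltW.
- rewrite ?maxxx mulr0.
  have H : h^-1 *: (sqpos (h *: 1 + 0) - sqpos 0) @[h --> 0^'] --> (0 : R).
    apply/cvgr0Pnorm_lt => eps eps0; near=> h.
    have h0 : h != 0 by near: h; exact: nbhs_dnbhs_neq.
    rewrite {2}/sqpos maxxx expr0n subr0 addr0 [h *: 1]mulr1 normrM normfV.
    have he : `|h| < eps by near: h; exact: dnbhs0_lt.
    rewrite mulrC ltr_pdivrMr ?normr_gt0// /sqpos normrX.
    apply: (@le_lt_trans _ _ (`|h| ^+ 2)); last by rewrite expr2 ltr_pM2r// normr_gt0.
    rewrite ler_pXn2r ?nnegrE// ger0_norm ?le_max ?lexx// ge_max normr_ge0 ler_norm//.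
  apply: DeriveDef; first by apply/cvg_ex; exists 0; exact: H.
  exact: (cvg_lim _ H).
Unshelve. all: by end_near.
Qed.

Variable g : E -> 'M[R]_n.
Hypothesis g_cont : continuous g.
Hypothesis g_pos : forall x u, u != 0 -> 0 < metric_form g x u u.

Lemma metric_norm_lower (p : E) r : exists2 m, 0 < m &
  forall x w, `|x - p| <= r -> m * `|w| <= metric_norm g x w.
Proof.
pose K : set (E * E) := [set x | `|x - p| <= r] `*` [set w | `|w| = 1].
have Kc : compact K.
  apply: compact_setX.
    apply: bounded_closed_compact.
      exists (r + `|p|); split; first exact: num_real.
      move=> M rM x /= xr; rewrite -(subrK p x) (le_trans (ler_normD _ _))//.
      by rewrite (le_trans _ (ltW rM))// lerD2r.
    apply: (@closed_comp _ _ (fun x : E => `|x - p|) [set t | t <= r]); last exact: closed_le.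
    move=> x _; apply: norm_cont; apply: sub_cont; [exact: id_cont|exact: cst_cont].
  apply: bounded_closed_compact.
    by exists 1; split; [exact: num_real|move=> M M1 x /= ->; exact: ltW].
  apply: (@closed_comp _ _ (fun x : E => `|x|) [set t | t = 1]); last exact: closed_eq.
  by move=> x _; exact: norm_continuous.
have [m m0 Hm] : exists2 m, 0 < m & forall x w, K (x, w) -> m <= metric_norm g x w.
  have [[z Kz]|K0] := pselect (K !=set0); last first.
    by exists 1 => // x w Kxw; case: K0; exists (x, w).
  have [|||[x0 w0]] := @compact_EVT_min _ R (fun xw : E * E => metric_norm g xw.1 xw.2) K.
  - by exists z.
  - exact: Kc.
  - by apply: continuous_subspaceT; apply: metric_norm_cont => // y; [exact: cvg_fst|exact: cvg_snd].
  rewrite inE => -[/= _ w01] Hmin; exists (metric_norm g x0 w0).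
    by rewrite sqrtr_gt0; apply: g_pos; rewrite -normr_gt0 w01.
  by move=> x w Kxw; apply: (Hmin (x, w)); rewrite inE.
exists m => // x w xr; have [->|w0] := eqVneq w 0; first by rewrite normr0 mulr0 metric_norm_ge0.
have nw : 0 < `|w| by rewrite normr_gt0.
have -> : metric_norm g x w = `|w| * metric_norm g x (`|w|^-1 *: w).
  by rewrite metric_normZ normfV normr_id mulrA divff ?mul1r// gt_eqF.
rewrite mulrC ler_pM2l//; apply: Hm; split=> //=.
by rewrite normrZ normfV normr_id mulVf// gt_eqF.
Qed.

(** By [calibration_dist], the Riemannian distance from p to the outside of the ball is at least N p
    > 0: points close to p for the distance cannot be far away in R^n. *)
Lemma bump_calibration (p : E) r : 0 < r -> exists N DN,
  [/\ C1_calibration g N DN, 0 < N p & forall x, r <= `|x - p| -> N x = 0].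
Proof.
move=> r0; have [m m0 Hm] := metric_norm_lower p r.
have n1 : 0 < n%:R + 1 :> R by rewrite ltr_wpDl.
(* The differential is bounded by k (2 r^2) (2 n r |w|) = m n / (n + 1) |w|; the 1 avoids a zero
   denominator when n = 0. *)
pose k := m / (4 * r ^+ 3 * (n%:R + 1)).
have k0 : 0 < k by rewrite divr_gt0// !mulr_gt0// exprn_gt0.
pose q (x : E) := dot (x - p) (x - p).
pose N (x : E) := k * sqpos (r ^+ 2 - q x).
pose DN (x w : E) := k * ((2 * Num.max 0 (r ^+ 2 - q x)) * - (2 * dot (x - p) w)).
have q_ge x : r <= `|x - p| -> r ^+ 2 - q x <= 0.
  move=> rx; rewrite subr_le0 (le_trans _ (norm_sqr_le_dot _))//.
  by rewrite ler_pXn2r ?nnegrE// ltW.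
exists N, DN; split; first split.
- move=> e t ed.
  have dq : is_derive t 1 (fun t => q (e t)) (2 * dot (e t - p) ('d e t 1)).
    have H i := is_deriveX 2 (is_deriveB (is_derive_coord i ed) (is_derive_cst (p 0 i) t 1)).
    have := is_derive_sum H.
    have -> : \sum_(i < n) ((fun t : R => e t 0 i) - cst (p 0 i)) ^+ 2 = (fun t : R => q (e t)).
      apply/funext => u; rewrite fct_sumE /q /dot; apply: eq_bigr => i _.
      by rewrite !mxE -expr2.
    move=> H'; apply: (is_derive_eq H'); rewrite /dot mulr_sumr; apply: eq_bigr => i _.
    by rewrite /= expr1 subr0 !mxE; exact/esym/mulrA.
  have H1 := is_deriveB (is_derive_cst (r ^+ 2) t 1) dq.
  have H2 := is_deriveZ k (is_derive1_comp (is_derive_sqpos _) H1).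
  by apply: (is_derive_eq H2); rewrite sub0r.
- move=> u w uc wc; apply: mul_cont; first exact: cst_cont.
  have upc : continuous (fun t => u t - p) by apply: sub_cont => //; exact: cst_cont.
  apply: mul_cont.
    apply: mul_cont; first exact: cst_cont.
    apply: max_cont; first exact: cst_cont.
    apply: sub_cont; first exact: cst_cont.
    exact: dot_cont.
  have -> : (fun t => - (2 * dot (u t - p) (w t))) = (fun t => (- 2) * dot (u t - p) (w t)).
    by apply/funext => t; rewrite mulNr.
  by apply: mul_cont; [exact: cst_cont|exact: dot_cont].
- move=> x w; have [rx|xr] := leP r `|x - p|.
    by rewrite /DN max_l ?q_ge// mulr0 mul0r mulr0 metric_norm_ge0.
  apply: le_trans (Hm x w (ltW xr)).
  have qr : Num.max 0 (r ^+ 2 - q x) <= r ^+ 2.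
    by rewrite ge_max sqr_ge0 lerBlDr lerDl dot_ge0.
  have dxw : - (2 * dot (x - p) w) <= 2 * (n%:R * r * `|w|).
    rewrite -mulrN ler_pM2l// (le_trans (ler_norm _))// normrN (le_trans (norm_dot _ _))//.
    by rewrite ler_wpM2r// ler_wpM2l// ltW.
  have rhs0 : 0 <= 2 * (n%:R * r * `|w|) by rewrite !mulr_ge0// ltW.
  have M0 : 0 <= 2 * Num.max 0 (r ^+ 2 - q x) by rewrite mulr_ge0// le_max lexx.
  apply: (@le_trans _ _ (k * ((2 * r ^+ 2) * (2 * (n%:R * r * `|w|))))).
    rewrite ler_pM2l//; apply: (le_trans (ler_wpM2l M0 dxw)).
    by rewrite ler_wpM2r// ler_pM2l.
  have -> : k * ((2 * r ^+ 2) * (2 * (n%:R * r * `|w|))) = m * (n%:R / (n%:R + 1)) * `|w|.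
    by rewrite /k; field; rewrite !gt_eqF.
  apply: ler_wpM2r => //; apply: ler_piMr; first exact: ltW.
  by rewrite ler_pdivrMr// mul1r lerDl.
- by rewrite /N /q subrr /dot big1 ?subr0 => [|i _]; rewrite ?mxE ?mul0r// mulr_gt0// /sqpos max_r ?sqr_ge0// !exprn_gt0.
- by move=> x /q_ge qx; rewrite /N /sqpos max_l// expr0n mulr0.
Qed.

End Bump.

Section HopfRinow.
Context {R : realType} {n : nat}.
Local Notation E := 'rV[R]_n.
Variable g : E -> 'M[R]_n.
Hypothesis g_cont : continuous g.
Hypothesis g_pos : forall x u, u != 0 -> 0 < metric_form g x u u.
Hypothesis g_complete : complete_metric g.

(* As in the Hopf-Rinow theorem. If T is the supremum of the good lengths, take
   polygons of length T + 1/k escaping to infinity. Along an ultrafilter, their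
   points at distance eps before the end converge, to p_eps say; the p_eps form
   a Cauchy sequence, and near its limit the end points cannot escape. *)
Lemma reach_bounded (K : set E) L : compact K ->
  exists B, forall x y, K x -> reach g x L y -> `|y| <= B.
Proof.
move=> /compact_norm_le[BK BK0 HK].
pose bd T := exists B, forall x y, K x -> reach g x T y -> `|y| <= B.
have bd0 T : T <= 0 -> bd T.
  by move=> T0; exists 0 => x y _ /reach_gt0; rewrite ltNge T0.
apply: contrapT => nbd.
have bd_lt T : bd T -> T <= L.
  move=> [B HB]; rewrite leNgt; apply/negP => LT; apply: nbd; exists B => x y Kx rxy.
  by apply: HB Kx _; apply: reach_le rxy; exact: ltW.
have hs : has_sup bd by split; [exists 0; exact: bd0|exists L].
have [T Tsup] : exists T, T = sup bd by exists (sup bd).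
have nb k : exists xy : E * E, [/\ K xy.1, reach g xy.1 (T + k.+1%:R^-1) xy.2 & k%:R < `|xy.2|].
  apply: contrapT => H.
  have : bd (T + k.+1%:R^-1).
    exists k%:R => x y Kx rxy; rewrite leNgt; apply/negP => yk; apply: H.
    by exists (x, y).
  by move=> /(sup_upper_bound hs); rewrite -Tsup gerDl leNgt invr_gt0 ltr0n.
have [xy Hxy] := choice nb.
pose y k := (xy k).2.
have split_at eps : 0 < eps -> exists B, forall k, exists m, `|m| <= B /\
    reach g m (eps + k.+1%:R^-1) (y k).
  move=> e0; have [T' /[dup] bT' [B HB]] := sup_adherent e0 hs; rewrite -Tsup => T'T.
  have T'le : T' <= T by rewrite Tsup; exact: sup_upper_bound hs _ bT'.
  (* For T' <= 0 the bound is vacuous, but then T < eps and the starting points, which lie in K, can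
     be taken. *)
  have [T'0|T'0] := leP T' 0.
    exists BK => k; have [Kx rxy _] := Hxy k; exists (xy k).1; split; first exact: HK.
    by apply: reach_le rxy; rewrite lerD2r; lra.
  exists B => k; have [Kx rxy _] := Hxy k.
  have k0 : 0 < k.+1%:R^-1 :> R by rewrite invr_gt0.
  have [|m [rxm rmy]] := reach_split (a := T') rxy; first by apply/andP; split=> //; exact: le_lt_trans T'le (ltr_pwDr k0 (lexx _)).
  exists m; split; first exact: HB Kx rxm.
  by apply: reach_le rmy; rewrite addrAC lerD2r; lra.
(* One ultrafilter serves every eps, so any two of the limit points are joined through a common end
   point y k. *)
have [U [UU Usub]] := @ultraFilterLemma nat \oo _.
have Upf : ProperFilter U by exact: ultra_proper.
have inv_small (eps : R) : 0 < eps -> \forall k \near U, k.+1%:R^-1 < eps.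
  by move=> e0; apply: Usub; exact: near_infty_natSinv_lt (PosNum e0).
have limit_pt eps : 0 < eps -> exists p, \forall k \near U, reach g p (3 * eps) (y k).
  move=> e0; have [B /choice[m Hm]] := split_at eps e0.
  have Km : (m @ U) [set x : E | `|x| <= B].
    by apply: (@filterE _ U) => k; have [] := Hm k.
  have [p [_ clp]] := @closed_ball_compact R n B (m @ U) _ Km.
  exists p.
  have seg_p : \forall k \near U, seg g p (m k) eps.
    have [//|nV] := in_ultra_setVsetC [set k | seg g p (m k) eps] UU.
    have [z [nz sz]] := clp (~` [set z | seg g p z eps]) _ nV (seg_near g_cont p e0).
    by case: (nz sz).
  apply: filterS2 seg_p (inv_small _ e0) => k sk ke.
  have -> : 3 * eps = eps + (eps + eps) by ring.
  apply: reach_trans (reach_seg sk) _; have [_] := Hm k.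
  by apply: reach_le; rewrite lerD2l ltW.
have ej j : 0 < j.+1%:R^-1 :> R by rewrite invr_gt0.
have [u Hu] := choice (fun j => limit_pt _ (ej j)).
have uu i j : riemannian_dist g (u i) (u j) <= 3 * i.+1%:R^-1 + 3 * j.+1%:R^-1.
  have [k [ri rj]] := filter_ex (filterI (Hu i) (Hu j)).
  by apply: reach_dist => //; apply: reach_trans ri _; exact: reach_sym.
have [l ul] : exists l, riemannian_dist g (u k) l @[k --> \oo] --> 0.
  apply: g_complete => eps e0.
  have e6 : 0 < eps / 6 by rewrite divr_gt0.
  have [N _ HN] := near_infty_natSinv_lt (PosNum e6).
  exists N => i j Ni Nj; apply: le_lt_trans (uu i j) _.
  have Hi : i.+1%:R^-1 < eps / 6 := HN i Ni.
  have Hj : j.+1%:R^-1 < eps / 6 := HN j Nj.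
  have -> : eps = 3 * (eps / 6) + 3 * (eps / 6) by field.
  by rewrite ltrD// ltr_pM2l.
have [N [DN [cal Nl Nout]]] := bump_calibration g_cont g_pos l ltr01.
(* The way from l through u j to y k is shorter than 2 d = N l / 2, whereas N drops along it from N
   l to 0. *)
pose d := N l / 4; have d0 : 0 < d by rewrite divr_gt0.
have d3 : 0 < d / 3 by rewrite divr_gt0.
have [j [uj ej3]] : exists j, riemannian_dist g (u j) l < d /\ 3 * j.+1%:R^-1 < d.
  have A1 : \forall j \near \oo, riemannian_dist g (u j) l < d by move/cvgr_lt: ul; apply.
  have A2 : \forall j \near \oo, j.+1%:R^-1 < d / 3 := near_infty_natSinv_lt (PosNum d3).
  have [j [B1 B2]] := filter_ex (filterI A1 A2); exists j; split=> //.
  by rewrite mulrC -ltr_pdivlMr.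
have Nuj := calibration_dist g_cont (u j) l cal.
have [k [rk yk]] : exists k, reach g (u j) (3 * j.+1%:R^-1) (y k) /\ `|l| + 1 < `|y k|.
  have big : \forall k \near U, `|l| + 1 < `|y k|.
    apply: Usub; have A : \forall k \near \oo, `|l| + 1 <= k%:R :> R by exact: nbhs_infty_ger.
    by apply: filterS A => k; have [_ _] := Hxy k; move=> h1 h2; exact: le_lt_trans h1.
  by have [k [? ?]] := filter_ex (filterI (Hu j) big); exists k.
have Nyk := calibration_dist g_cont (y k) (u j) cal.
have dyk := reach_dist g_cont (reach_sym rk).
have : N (y k) = 0.
  apply: Nout; have := ler_normD (y k - l) l; rewrite subrK; lra.
move=> Ny.
have h1 : N (u j) < d.
  by rewrite -[N (u j)]subr0 -Ny; exact: le_lt_trans Nyk (le_lt_trans dyk ej3).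
have h2 : N l - N (u j) < d := le_lt_trans Nuj uj.
have : N l < d + d by rewrite -(subrK (N (u j)) (N l)) ltrD.
by apply/negP; rewrite -leNgt /d (_ : N l / 4 + N l / 4 = N l / 2) ?ler_pdivrMr ?ler_peMr ?ler1n ?ltW//; field.
Qed.

End HopfRinow.

(** * Pushing compact sets upwards *)

Section Euler.
Context {R : realType} {n : nat}.
Local Notation E := 'rV[R]_n.

Lemma det_cont {T : topologicalType} {m} (M : T -> 'M[R]_m) :
  continuous M -> continuous (fun x => \det (M x)).
Proof.
move=> Mc; apply: sum_cont => s; apply: mul_cont; first exact: cst_cont.
by apply: prod_cont => i; exact: coord_cont.
Qed.

Lemma adj_cont {T : topologicalType} {m} (M : T -> 'M[R]_m) :
  continuous M -> continuous (fun x => \adj (M x)).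
Proof.
move=> Mc; apply: mx_continuous => i j; under eq_fun do rewrite mxE.
apply: mul_cont; first exact: cst_cont.
apply: det_cont; apply: mx_continuous => k l; under eq_fun do rewrite !mxE.
exact: coord_cont.
Qed.

Lemma mulmx_cont {T : topologicalType} {m p q} (M : T -> 'M[R]_(m, p)) (N : T -> 'M[R]_(p, q)) :
  continuous M -> continuous N -> continuous (fun x => M x *m N x).
Proof.
move=> Mc Nc; apply: mx_continuous => i j; under eq_fun do rewrite mxE.
by apply: sum_cont => k; apply: mul_cont; exact: coord_cont.
Qed.

Variables (g : E -> 'M[R]_n) (h : E -> R) (A : E -> E).
Hypothesis g_riem : riemannian_metric g.
Hypothesis g_complete : complete_metric g.
Hypothesis h_diff : forall x, differentiable h x.
Hypothesis hA : forall x w, 'd h x w = dot (A x) w.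
Hypothesis A_cont : continuous A.
Variable c : R.
Hypothesis c_gt0 : 0 < c.
Hypothesis c_le : forall x, c <= metric_norm g x (gradient g h x).

Let g_cont : continuous g.
Proof. by have [gs _ _] := g_riem; move=> x; exact: (gs 0%N). Qed.

Let g_pos x u : u != 0 -> 0 < metric_form g x u u.
Proof. by have [_ _ ] := g_riem; apply. Qed.

Let Y x : E := A x *m \adj (g x).
(* This is grad h / |grad h|^2, see slope_fieldE; the adjugate makes its
   continuity in x apparent. *)
Definition slope_field x : E := (dot (A x) (Y x))^-1 *: Y x.

Lemma slope_fieldE x : let N := metric_norm g x (gradient g h x) in
  dot (A x) (Y x) != 0 /\ slope_field x = N ^- 2 *: gradient g h x.
Proof.
set G := gradient g h x; set N := metric_norm g x G; rewrite /=.
have N0 : 0 < N by exact: lt_le_trans (c_le x).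
have detN0 : \det (g x) != 0.
  rewrite -unitfE -[_ \is a _]/(g x \in unitmx) -row_free_unit -kermx_eq0.
  apply/rowV0P => u /sub_kermxP ug0; apply/eqP/negPn/negP => /(g_pos x).
  by rewrite /metric_form ug0 mul0mx mxE ltxx.
have YG : Y x = \det (g x) *: G.
  have -> : G = (\det (g x))^-1 *: Y x; last by rewrite scalerA mulfV// scale1r.
  apply/esym; apply: gradient_unique => // w.
  rewrite /metric_form -!scalemxAl /Y -(mulmxA (A x)) mul_adj_mx mul_mx_scalar -scalemxAl !mxE.
  rewrite mulrA mulVf// mul1r hA /dot; apply: eq_bigr => i _; by rewrite mxE.
have AG : dot (A x) G = N ^+ 2.
  by rewrite -hA -(gradientP h x g_riem) sqr_sqrtr// ltW// -sqrtr_gt0.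
have AY : dot (A x) (Y x) = \det (g x) * N ^+ 2 by rewrite YG dotC dotZl dotC AG.
have AY0 : dot (A x) (Y x) != 0 by rewrite AY mulf_neq0// expf_neq0// gt_eqF.
by split=> //; rewrite /slope_field AY YG scalerA invfM mulrAC mulVf// mul1r.
Qed.

Lemma slope_field_cont : continuous slope_field.
Proof.
have Yc : continuous Y by apply: mulmx_cont => //; exact: adj_cont.
apply: scale_cont => //; apply: inv_cont; last exact: dot_cont.
by move=> x; have [] := slope_fieldE x.
Qed.

Lemma slope_field_slope x : dot (A x) (slope_field x) = 1.
Proof. by have [AY _] := slope_fieldE x; rewrite /slope_field dotC dotZl [X in _ * X]dotC mulVf. Qed.

Lemma slope_field_norm x : metric_norm g x (slope_field x) <= c^-1.
Proof.
have [_ ->] := slope_fieldE x; rewrite metric_normZ.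
have N0 := lt_le_trans c_gt0 (c_le x).
rewrite ger0_norm ?invr_ge0 ?sqr_ge0// expr2 invfM -mulrA mulVf ?mulr1 ?gt_eqF//.
by rewrite lef_pV2.
Qed.

(** At s = 0 the norm is at most 1 / c and the slope is 1, so the weaker strict bounds are open
    conditions there, uniform over the ball by compactness. The bound 1 on eta keeps the rounding of
    the number of steps below 1. *)
Lemma uniform_slope B : exists2 eta, 0 < eta <= 1 &
  forall x s, `|x| <= B -> 0 <= s <= eta ->
   metric_norm g (x + s *: slope_field x) (slope_field x) <= 2 / c /\
   1 / 2 <= dot (A (x + s *: slope_field x)) (slope_field x).
Proof.
pose P (s : R) (x : E) :=
  metric_norm g (x + s *: slope_field x) (slope_field x) < 2 / c /\
   1 / 2 < dot (A (x + s *: slope_field x)) (slope_field x).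
have Xc : continuous (fun xs : E * R => slope_field xs.1).
  by apply: comp_cont slope_field_cont => z; exact: cvg_fst.
have pc : continuous (fun xs : E * R => xs.1 + xs.2 *: slope_field xs.1).
  apply: add_cont; first by move=> z; exact: cvg_fst.
  by apply: scale_cont => // z; exact: cvg_snd.
have H (x : E) : `|x| <= B -> \forall x' \near x & s \near (0 : R), P s x'.
  move=> _.
  have c1 := @metric_norm_cont R n g g_cont _ _ _ pc Xc.
  have c2 := dot_cont (comp_cont pc A_cont) Xc.
  have h1 : metric_norm g (x + 0 *: slope_field x) (slope_field x) < 2 / c.
    rewrite scale0r addr0 (le_lt_trans (slope_field_norm x))//.
    by rewrite ltr_pMl ?invr_gt0// ltr1n.
  have h2 : 1 / 2 < dot (A (x + 0 *: slope_field x)) (slope_field x).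
    by rewrite scale0r addr0 slope_field_slope; lra.
  have n1 := cvgr_lt _ (c1 (x, 0)) _ h1.
  have n2 := cvgr_gt _ (c2 (x, 0)) _ h2.
  have [[U1 V1] /= [U1n V1n] UV1] := n1; have [[U2 V2] /= [U2n V2n] UV2] := n2.
  exists (U1 `&` U2, V1 `&` V2) => /=; first by split; exact: filterI.
  by move=> [x' s] /= [[U1x U2x] [V1s V2s]]; split; [apply: (UV1 (x', s))|apply: (UV2 (x', s))].
have /compact_near_coveringP/(_ _ (nbhs (0 : R)) P _ H) := @closed_ball_compact R n B.
move=> /nbhs_normP[e /= e0 He].
exists (Num.min 1 (e / 2)).
  by apply/andP; split; [rewrite lt_min ltr01 divr_gt0|rewrite ge_min lexx].
move=> x s xB /andP[s0]; rewrite le_min => /andP[_ se].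
have [||p1 p2] := He s _ x; last by split; exact: ltW.
  rewrite /= sub0r normrN ger0_norm// (le_lt_trans se)// ltr_pdivrMr//.
  by rewrite ltr_pMr ?ltr1n.
exact: xB.
Qed.

Lemma slope_rise x s : 0 <= s ->
  (forall t, 0 <= t <= s -> 1 / 2 <= dot (A (x + t *: slope_field x)) (slope_field x)) ->
  h x + s / 2 <= h (x + s *: slope_field x).
Proof.
move=> s0 H; set X := slope_field x.
have Hd (t : R) : is_derive t 1 (fun t : R => h (x + t *: X)) (dot (A (x + t *: X)) X).
  have [ad av] := is_diff_affine x X t.
  have cd : differentiable (h \o (fun t : R => x + t *: X)) t by exact: differentiable_comp.
  apply: DeriveDef; first exact/derivable1_diffP.
  by rewrite (deriveE _ cd) diff_comp//= av hA scale1r.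
have [|t] := @MVT_segment R (fun t => h (x + t *: X)) (fun t => dot (A (x + t *: X)) X) 0 s s0.
  apply: continuous_subspaceT => t; apply: differentiable_continuous.
  by apply/derivable1_diffP; case: (Hd t).
rewrite in_itv/= => /H Ht; rewrite scale0r addr0 subr0 => e.
have : s / 2 <= dot (A (x + t *: X)) X * s.
  by rewrite mulrC ler_wpM2r//; move: Ht; rewrite /X mul1r.
by rewrite -e; lra.
Qed.

(** The Euler map F is iterated N times. Below the level b each step rises by at least eta / 2, and
    the steps fade out between b and b + eps. *)
Lemma ascending_push (b eps : R) (K : set E) : 0 < eps -> compact K ->
  exists r : E -> E, [/\ continuous r, forall x, b + eps <= h x -> r x = x &
    forall x, K x -> b < h (r x)].
Proof.
move=> eps0 Kc.
have hc : continuous h by move=> x; exact: differentiable_continuous.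
have [Q Q0 HQ] : exists2 Q, 0 < Q & forall x, K x -> b - Q < h x.
  have [[z Kz]|K0] := pselect (K !=set0); last first.
    by exists 1 => // x Kx; case: K0; exists x.
  have [|||x0 _ Hx0] := @compact_EVT_min E R h K.
  - by exists z.
  - exact: Kc.
  - exact: continuous_subspaceT.
  exists (`|b - h x0| + 1); first by rewrite ltr_wpDl.
  move=> x Kx; have : h x0 <= h x by apply: Hx0; rewrite inE.
  by have := ler_norm (b - h x0); lra.
(* Time 2 Q + 1 at speed 2 / c. This does not depend on the step size, so the choices are not
   circular: L gives B, B gives eta, and eta gives N with N eta <= 2 Q + 1. *)
pose L := (2 * Q + 1) * (2 / c).
have L0 : 0 < L by rewrite mulr_gt0 ?divr_gt0// addr_gt0// mulr_gt0.
have [B HB] := reach_bounded g_cont g_pos g_complete L Kc.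
have [eta /andP[eta0 eta1] Heta] := uniform_slope B.
pose tau x := Num.min 1 (Num.max 0 ((b + eps - h x) / eps)).
have tau01 x : 0 <= tau x <= 1.
  by rewrite /tau le_min ler01 le_max lexx ge_min lexx.
have tauc : continuous tau.
  apply: min_cont; first exact: cst_cont.
  apply: max_cont; first exact: cst_cont.
  apply: mul_cont; last exact: cst_cont.
  by apply: sub_cont => //; exact: cst_cont.
pose F x := x + (eta * tau x) *: slope_field x.
have Fc : continuous F.
  apply: add_cont; first exact: id_cont.
  apply: scale_cont; last exact: slope_field_cont.
  by apply: mul_cont => //; exact: cst_cont.
have etatau x : 0 <= eta * tau x <= eta.
  have /andP[t0 t1] := tau01 x.
  by rewrite mulr_ge0 ?(ltW eta0)//= ler_piMr// ltW.
have Fseg x : `|x| <= B -> seg g x (F x) (eta * (2 / c)).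
  move=> xB; split; first by rewrite mulr_gt0// divr_gt0.
  move=> t /andP[t0 t1]; have /andP[e0 e1] := etatau x.
  have -> : F x - x = (eta * tau x) *: slope_field x by rewrite /F addrAC subrr add0r.
  rewrite scalerA metric_normZ ger0_norm//; apply: ler_pM => //; first exact: metric_norm_ge0.
  have [] := Heta x (t * (eta * tau x)) xB => //.
  by rewrite mulr_ge0//= (le_trans _ e1)// ler_piMl.
have Frise x : `|x| <= B -> h x + eta * tau x / 2 <= h (F x).
  move=> xB; have /andP[e0 e1] := etatau x.
  apply: slope_rise => // t /andP[t0 t1].
  by have [] := Heta x t xB => //; rewrite t0 (le_trans t1).
have [N [N1 N2]] : exists N : nat, 2 * Q <= N%:R * eta /\ N%:R * eta <= 2 * Q + 1.
  have /truncn_itv/andP[t1 t2] : 0 <= 2 * Q / eta by rewrite divr_ge0 ?mulr_ge0// ltW.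
  exists (Num.truncn (2 * Q / eta)).+1; split.
    by rewrite -ler_pdivrMr// ltW.
  by rewrite -natr1 mulrDl mul1r lerD// -ler_pdivlMr.
have Fin x k : K x -> (k <= N)%N -> `|iter k F x| <= B.
  move=> Kx; suff : (k <= N)%N -> `|iter k F x| <= B /\
      ((0 < k)%N -> reach g x (k%:R * (eta * (2 / c))) (iter k F x)).
    by move=> H /H[].
  (* Polygons have positive weight, so k = 0 is treated apart, with a constant edge of weight L. *)
  elim: k => [_|k IH kN].
    split=> //; apply: (HB x) => //; apply: reach_seg; split=> // t _.
    by rewrite subrr metric_norm0 ltW.
  have [Bk rk] := IH (ltnW kN); have sk := Fseg _ Bk.
  have rk1 : reach g x (k.+1%:R * (eta * (2 / c))) (iter k.+1 F x).
    case: k rk sk {IH kN Bk} => [|k] rk sk; first by rewrite mul1r; exact: reach_seg.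
    by rewrite -natr1 mulrDl mul1r; apply: reach_step sk; exact: rk.
  split=> //; apply: (HB x) => //; apply: reach_le rk1.
  rewrite mulrA /L ler_pM2r ?divr_gt0// (le_trans _ N2)// ler_pM2r//.
  by rewrite ler_nat.
exists (iter N F); split.
- by elim: (N) => [|k IH] /=; [exact: id_cont|exact: (comp_cont IH Fc)].
- move=> x hx; have Fx : F x = x.
    have -> : F x = x + (eta * 0) *: slope_field x; last by rewrite mulr0 scale0r addr0.
    rewrite /F; congr (_ + (_ * _) *: _); rewrite /tau max_l ?min_r//.
    by rewrite pmulr_lle0 ?invr_gt0// subr_le0.
  by elim: (N) => [//|k IH] /=; rewrite IH.
- move=> x Kx.
  (* No step descends, so an iterate above b stays there; until then every step is a full one. *)
  have : forall k, (k <= N)%N -> b < h (iter k F x) \/ h x + k%:R * eta / 2 <= h (iter k F x).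
    elim=> [_|k IH kN]; first by right; rewrite mul0r mul0r addr0.
    have hk := Frise _ (Fin x k Kx (ltnW kN)).
    have /andP[e0 e1] := etatau (iter k F x).
    case: (IH (ltnW kN)) => [bk|hxk].
      by left; rewrite iterS (lt_le_trans bk)// (le_trans _ hk)// lerDl divr_ge0.
    have [kb|bk] := leP (h (iter k F x)) b; last first.
      by left; rewrite iterS (lt_le_trans bk)// (le_trans _ hk)// lerDl divr_ge0.
    right; rewrite iterS (le_trans _ hk)//.
    have -> : tau (iter k F x) = 1.
      rewrite /tau min_l// le_max; apply/orP; right.
      by rewrite ler_pdivlMr// mul1r; lra.
    by rewrite -natr1 mulrDl mul1r mulr1 [X in _ + X]mulrDl addrA lerD2r.
  move=> /(_ N (leqnn N))[//|hN].
  apply: lt_le_trans hN; have := HQ x Kx; move: N1; lra.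
Qed.

End Euler.

(** * Bijectivity *)

Section Assembly.
Local Open Scope classical_set_scope.
Context {R : realType} {n : nat}.
Local Notation E := 'rV[R]_n.

Lemma differentiable_approx {V W : normedModType R} (f : V -> W) a k :
  differentiable f a -> 0 < k ->
  exists2 d, 0 < d & forall u, `|u| < d -> `|f (u + a) - f a - 'd f a u| <= k * `|u|.
Proof.
move=> /diff_locally/eqaddoP H k0; have /nbhs_normP[d /= d0 Hd] := H k k0.
exists d => // u ud; have := Hd u; rewrite /= sub0r normrN => /(_ ud).
by rewrite /= opprD addrA.
Qed.

Lemma differentiable_lip {V W : normedModType R} (f : V -> W) a :
  differentiable f a ->
  exists2 C, 0 < C & exists2 d, 0 < d & forall u, `|u| < d -> `|f (u + a) - f a| <= C * `|u|.
Proof.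
move=> df; have [d d0 Hd] := differentiable_approx df ltr01.
have [C C0 HC] := linear_lipschitz (diff_continuous df).
exists (1 + C); first by rewrite addr_gt0.
exists d => // u /Hd Hu; rewrite -[f _ - _](subrK ('d f a u)).
by rewrite (le_trans (ler_normD _ _))// mulrDl lerD.
Qed.

Variable f : E -> E.
Hypothesis f_ld : local_diffeomorphism f.

Lemma local_diffeo_differentiable x : differentiable f x.
Proof. by have [U [U' [h [[_ Ux _] [_ _ fs _]]]]] := f_ld x; have [+ _] := fs 1%N; apply. Qed.

Lemma local_diffeo_continuous : continuous f.
Proof. by move=> x; apply/differentiable_continuous/local_diffeo_differentiable. Qed.

Lemma local_diffeo_diff_continuous w : continuous (fun x => 'd f x w).
Proof.
move=> x; have [U [U' [h [[_ Ux _] [_ _ fs _]]]]] := f_ld x.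
by have [_ /(_ w)] := fs 1%N; apply.
Qed.

(** All that is needed of the smoothness of the inverse: continuity near f a and a Lipschitz bound
    at f a. *)
Lemma local_inverse a : exists (h : E -> E) (r C : R),
  [/\ 0 < r, 0 < C & h (f a) = a] /\
  [/\ forall w, `|w| < r -> f (h (w + f a)) = w + f a,
      forall w, `|w| < r -> {for w + f a, continuous h},
      forall w, `|w| < r -> `|h (w + f a) - a| <= C * `|w| &
      exists2 d, 0 < d & forall u, `|u| < d -> h (f (u + a)) = u + a].
Proof.
have [U [U' [h [[Uo Ua U'o] [fbij fh fs hs]]]]] := f_ld a.
have U'fa : U' (f a) by have [/(_ a Ua)] := fbij.
have hfa : h (f a) = a by rewrite fh ?inE.
have hd : differentiable h (f a) by have [+ _] := hs 1%N; apply.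
have [C C0 [d1 d10 Hd1]] := differentiable_lip hd.
move: (U'o); rewrite openE => /(_ _ U'fa)/nbhs_normP[d2 /= d20 Hd2].
move: (Uo); rewrite openE => /(_ _ Ua)/nbhs_normP[d3 /= d30 Hd3].
exists h, (Num.min d1 d2), C; split; first by split=> //; rewrite lt_min d10.
have U'w w : `|w| < d2 -> U' (w + f a).
  by move=> wd; apply: Hd2; rewrite /= opprD addrCA subrr addr0 normrN.
split.
- move=> w; rewrite lt_min => /andP[_ /U'w]; case: fbij => _ _ /[apply] -[x Ux fx].
  by rewrite -fx fh ?inE.
- by move=> w; rewrite lt_min => /andP[_ /U'w]; exact: (hs 0%N).
- by move=> w; rewrite lt_min => /andP[/Hd1 + _]; rewrite hfa.
- exists d3 => // u ud; rewrite fh// inE; apply: Hd3.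
  by rewrite /= opprD addrCA subrr addr0 normrN.
Qed.

(** By the Lipschitz bound on the inverse, f moves a + t u at least |t u| / C away from f a, but if
    the differential kills u, at most |t u| / (2 C) for small t. *)
Lemma local_diffeo_diff_inj a u : 'd f a u = 0 -> u = 0.
Proof.
move=> dfu; have [h [r [C [[r0 C0 hfa] [_ _ hlip [d d0 hK]]]]]] := local_inverse a.
apply: contrapT => /eqP u0; have nu : 0 < `|u| by rewrite normr_gt0.
have k0 : 0 < (2 * C)^-1 by rewrite invr_gt0 mulr_gt0.
have [d' d'0 Hd'] := differentiable_approx (local_diffeo_differentiable a) k0.
have [t t0 Ht] : exists2 t, 0 < t & [/\ `|t *: u| < d, `|t *: u| < d' & (2 * C)^-1 * `|t *: u| < r].
  pose m := Num.min d (Num.min d' (2 * C * r)).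
  have m0 : 0 < m by rewrite !lt_min d0 d'0 !mulr_gt0.
  exists (m / (2 * `|u|)); first by rewrite divr_gt0// mulr_gt0.
  have -> : `|(m / (2 * `|u|)) *: u| = m / 2.
    rewrite normrZ ger0_norm ?divr_ge0 ?mulr_ge0 ?ltW//; field; by rewrite gt_eqF.
  have m2 : m / 2 < m by rewrite ltr_pdivrMr// ltr_pMr ?ltr1n.
  split; try by apply: lt_le_trans m2 _; rewrite !ge_min lexx ?orbT.
  rewrite mulrC ltr_pdivrMr ?mulr_gt0// [ltRHS]mulrC; apply: lt_le_trans m2 _; by rewrite !ge_min lexx ?orbT.
have tu0 : 0 < `|t *: u| by rewrite normrZ mulr_gt0// normr_gt0 gt_eqF.
have [td td' tr] := Ht.
have := Hd' _ td'; rewrite linearZ /= dfu scaler0 subr0 => ftu.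
have := hlip (f (t *: u + a) - f a) (le_lt_trans ftu tr); rewrite subrK hK// addrK.
apply/negP; rewrite -ltNge (le_lt_trans (ler_wpM2l (ltW C0) ftu))//.
by rewrite mulrA invfM mulrCA mulfV ?gt_eqF// mulr1 gtr_pMl// invf_lt1 ?ltr1n.
Qed.

Hypothesis f_push : forall y, pushable (fun x => f x - y).

Lemma pushable_surjective y : exists x, f x = y.
Proof.
have fyc : continuous (fun x => f x - y) by apply: sub_cont; [exact: local_diffeo_continuous|exact: cst_cont].
pose K : set E := [set z | `|z| = 1].
have Kcl : closed K.
  by apply: (@closed_comp _ _ (fun z : E => `|z|) [set t | t = 1]) => [z _|]; [exact: norm_continuous|exact: closed_eq].
have Kc : compact K.
  by apply: subclosed_compact Kcl (@closed_ball_compact R n 1) _ => z /= ->.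
have [||z Kz|//|s [sc _ sp]] := pos_selection fyc (@f_push y) Kc Kcl closed0 (v := id) (s := fun=> 0).
- exact: id_cont.
- exact: cst_cont.
- by rewrite -normr_gt0 Kz.
have [z _ /eqP] := acute_field_zero (comp_cont sc fyc) sp.
by rewrite subr_eq0 => /eqP; exists (s z).
Qed.

(** Radial retraction onto the ball of radius 2: composed with it, the local inverses become
    continuous on the whole space. *)
Definition clamp (z : E) : E := (2 / Num.max 2 `|z|) *: z.

Lemma clamp_cont : continuous clamp.
Proof.
apply: scale_cont; last exact: id_cont.
apply: mul_cont; first exact: cst_cont.
apply: inv_cont => [z|]; first by rewrite gt_eqF// lt_max ltr0n.
by apply: max_cont; [exact: cst_cont|exact: norm_cont id_cont].
Qed.

Lemma clamp_id z : `|z| <= 2 -> clamp z = z.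
Proof. by move=> z2; rewrite /clamp max_l// divff ?scale1r// pnatr_eq0. Qed.

Lemma clamp_le z : `|clamp z| <= 2.
Proof.
rewrite normrZ ger0_norm ?divr_ge0 ?le_max ?ler0n//.
by rewrite mulrAC ler_pdivrMr ?lt_max ?ltr0n// ler_pM2l// le_max lexx orbT.
Qed.

(** With w = eps z and u the displacement of the inverse, the differential of u is w up to |u| / ((n
    + 1) C) <= 2 eps / (n + 1). Against z this error costs at most 4 eps n / (n + 1), less than the
    4 eps guaranteed by <w, z>. *)
Lemma local_inverse_acute a h r C : 0 < r -> 0 < C -> h (f a) = a ->
  (forall w, `|w| < r -> f (h (w + f a)) = w + f a) ->
  (forall w, `|w| < r -> `|h (w + f a) - a| <= C * `|w|) ->
  exists2 d, 0 < d & forall eps z, 0 < eps -> `|z| = 2 -> 2 * eps < d ->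
    0 < dot ('d f a (h (eps *: z + f a) - a)) z.
Proof.
move=> r0 C0 hfa fh hlip.
have k0 : 0 < ((n%:R + 1) * C)^-1 by rewrite invr_gt0 mulr_gt0// ltr_wpDl.
have [d d0 Hd] := differentiable_approx (local_diffeo_differentiable a) k0.
exists (Num.min r (d / C)); first by rewrite lt_min r0 divr_gt0.
move=> eps z e0 z2; rewrite lt_min => /andP[er ed].
set w := eps *: z; set u := h (w + f a) - a.
have nw : `|w| = 2 * eps by rewrite /w normrZ z2 gtr0_norm// mulrC.
have uC : `|u| <= C * `|w| by apply: hlip; rewrite nw.
have ud : `|u| < d by rewrite (le_lt_trans uC)// mulrC -ltr_pdivlMr// nw.
have := Hd u ud; rewrite /u subrK fh ?nw// addrK -/u => err.
have -> : dot ('d f a u) z = dot w z - dot (w - 'd f a u) z by rewrite dotBl subKr.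
have wz : eps * 4 <= dot w z.
  rewrite dotZl ler_pM2l//; have := norm_sqr_le_dot z; rewrite z2; lra.
have : dot (w - 'd f a u) z <= n%:R * (((n%:R + 1) * C)^-1 * (C * (2 * eps))) * 2.
  rewrite (le_trans (ler_norm _))// (le_trans (norm_dot _ _))// z2 ler_pM2r//.
  apply: ler_wpM2l => //; apply: le_trans err _; apply: ler_wpM2l; first exact: ltW.
  by rewrite -nw.
have -> : n%:R * (((n%:R + 1) * C)^-1 * (C * (2 * eps))) * 2 = (n%:R / (n%:R + 1)) * (4 * eps).
  have N1 : n%:R + 1 != 0 :> R by rewrite natr1 pnatr_eq0.
  by field; rewrite N1 gt_eqF.
have : n%:R / (n%:R + 1) < 1 :> R by rewrite ltr_pdivrMr ?mul1r ?ltrDl// ltr_wpDl.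
move=> n1; rewrite subr_gt0 => H; apply: le_lt_trans H _; apply: lt_le_trans wz.
by rewrite [ltRHS]mulrC gtr_pMl// mulr_gt0.
Qed.

Lemma pushable_injective : injective f.
Proof.
move=> a b fab; apply: contrapT => ab.
have [ha [ra [Ca [[ra0 Ca0 haf] [fha hac halip _]]]]] := local_inverse a.
have [hb [rb [Cb [[rb0 Cb0 hbf] [fhb hbc hblip _]]]]] := local_inverse b.
have [d d0 Hd] := local_inverse_acute ra0 Ca0 haf fha halip.
pose eps := Num.min d (Num.min ra rb) / 4.
have m0 : 0 < Num.min d (Num.min ra rb) by rewrite !lt_min d0 ra0.
have eps0 : 0 < eps by rewrite divr_gt0.
have eps2 : 2 * eps < Num.min d (Num.min ra rb) by rewrite /eps; lra.
move: (eps2); rewrite !lt_min => /and3P[ed ea eb].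
set y := f a in haf fha hac halip Hd.
have fb : f b = y by [].
rewrite fb in hbf fhb hbc hblip.
pose arg z := eps *: clamp z + y.
have argn z : `|eps *: clamp z| <= 2 * eps.
  by rewrite normrZ gtr0_norm// mulrC ler_pM2r// clamp_le.
have argc : continuous arg.
  by apply: add_cont; [apply: scale_cont; [exact: cst_cont|exact: clamp_cont]|exact: cst_cont].
pose sa z := ha (arg z); pose sb z := hb (arg z).
have sac : continuous sa.
  move=> z; apply: (@continuous_comp _ _ _ arg ha); first exact: argc.
  by apply: hac; exact: le_lt_trans (argn z) ea.
have sbc : continuous sb.
  move=> z; apply: (@continuous_comp _ _ _ arg hb); first exact: argc.
  by apply: hbc; exact: le_lt_trans (argn z) eb.
have fsa z : `|z| <= 2 -> f (sa z) - y = eps *: z.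
  move=> z2; rewrite /sa /arg fha ?addrK ?clamp_id//.
  by have := le_lt_trans (argn z) ea; rewrite clamp_id.
have fsb z : `|z| <= 2 -> f (sb z) - y = eps *: z.
  move=> z2; rewrite /sb /arg fhb ?addrK ?clamp_id//.
  by have := le_lt_trans (argn z) eb; rewrite clamp_id.
pose K : set E := [set z | 1 <= `|z|] `&` [set z | `|z| <= 2].
pose B : set E := [set z | `|z| <= 1].
pose L : set E := [set z | `|z| = 1] `|` [set z | `|z| = 2].
have ncl (A : set R) : closed A -> closed [set z : E | A `|z|].
  by move=> Acl; apply: (@closed_comp _ _ (fun z : E => `|z|) A) => // z _; exact: norm_continuous.
have ge1cl : closed [set z : E | 1 <= `|z|] := ncl _ (@closed_ge R 1).
have Kcl : closed K by apply: closedI => //; exact: ncl (@closed_le R 2).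
have Kc : compact K.
  by apply: subclosed_compact Kcl (@closed_ball_compact R n 2) _ => z [].
have sphere_cl r : closed [set z : E | `|z| = r] := ncl _ (@closed_eq R r).
have Lcl : closed L by exact: closedU.
pose s z := (2 - `|z|) *: sb z + (`|z| - 1) *: sa z.
have sc : continuous s.
  have nc : continuous (fun z : E => `|z|) by apply: norm_cont; exact: id_cont.
  have c2 : continuous (fun z : E => 2 - `|z|) by apply: sub_cont => //; exact: cst_cont.
  have c1 : continuous (fun z : E => `|z| - 1) by apply: sub_cont => //; exact: cst_cont.
  by apply: add_cont; exact: scale_cont.
have s1 z : `|z| = 1 -> s z = sb z by move=> z1; rewrite /s z1 subrr scale0r addr0 (_ : 2 - 1 = 1) ?scale1r//; lra.
have s2 z : `|z| = 2 -> s z = sa z by move=> z1; rewrite /s z1 subrr scale0r add0r (_ : 2 - 1 = 1) ?scale1r//; lra.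
have fyc : continuous (fun x => f x - y) by apply: sub_cont; [exact: local_diffeo_continuous|exact: cst_cont].
have [||z [z1 _]|z [_ /= z2] Lz|H [Hc HL Hp]] := pos_selection fyc (@f_push y) Kc Kcl Lcl (v := id) (s := s).
- exact: id_cont.
- exact: sc.
- by rewrite -normr_gt0 (lt_le_trans ltr01).
- have z0 : z != 0 by rewrite -normr_gt0; case: Lz => /= ->.
  have -> : f (s z) - y = eps *: z.
    by case: Lz => /= zn; [rewrite s1// fsb|rewrite s2// fsa].
  by rewrite dotZl mulr_gt0// dot_gt0.
have [||||||z Bz [z1 _]|G [Gc GB GK]] := @continuous_glue R n E B K sb H.
- exact: closed_ball_compact.
- exact: ncl (@closed_le R 1).
- by [].
- by [].
- by [].
- by [].
- have zn : `|z| = 1 by apply/eqP; rewrite eq_le Bz.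
  rewrite HL ?s1//; last by left.
  by split=> /=; rewrite zn//; lra.
(* In the inner ball f (G z) - y = eps z vanishes only at 0, where G is b; in the shell its product
   with z is positive. But f a = y. *)
have Ga z : `|z| <= 2 -> G z != a.
  move=> z2; apply/eqP => Gz; have [z1|z1] := leP `|z| 1.
    move: Gz; rewrite GB// => sba; have := fsb _ z2; rewrite sba subrr => /esym/eqP.
    rewrite scaler_eq0 gt_eqF//= => /eqP z0; apply: ab; rewrite -sba z0 /sb /arg.
    by rewrite clamp_id ?normr0// scaler0 add0r.
  have Kz : K z by split=> //; exact: ltW.
  have := Hp z Kz; rewrite -GK// Gz subrr /dot big1 ?ltxx// => i _; by rewrite mxE mul0r.
(* G z - a itself need not point outwards; its image under the differential is close to eps z on the
   boundary, and injectivity of the differential keeps the zeros the same. *)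
pose F (z : E) := 'd f a (G (2 *: z) - a).
have Fc : continuous F.
  apply: comp_cont; last by apply: diff_continuous; exact: local_diffeo_differentiable.
  apply: sub_cont; last exact: cst_cont.
  by apply: comp_cont Gc; apply: scale_cont; [exact: cst_cont|exact: id_cont].
have [z z1|z z1 Fz] := acute_field_zero Fc.
  have z2 : `|2 *: z| = 2 by rewrite normrZ z1 mulr1 ger0_norm.
  rewrite /F GK; last by split=> /=; rewrite z2//; lra.
  rewrite HL; [|by split=> /=; rewrite z2//; lra|by right].
  rewrite s2// /sa /arg clamp_id ?z2//.
  have := Hd eps (2 *: z) eps0 z2 ed; rewrite [in X in _ < X]dotC dotZl dotC.
  by rewrite pmulr_rgt0.
have := Ga (2 *: z); rewrite normrZ ger0_norm//.
rewrite (_ : 2 * `|z| <= 2); last by rewrite ler_piMr.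
move=> /(_ isT); rewrite -subr_eq0 => /eqP; apply; exact: local_diffeo_diff_inj Fz.
Qed.

Theorem pushable_bijective : bijective f.
Proof.
have [g fg] := choice pushable_surjective.
by exists g => [x|x]; rewrite ?fg//; apply: pushable_injective; rewrite fg.
Qed.

End Assembly.

(** * From the slope bound on height functions to [pushable] *)

Section Height.
Context {R : realType} {n : nat}.
Local Notation E := 'rV[R]_n.

Lemma is_diff_height (f : E -> E) (v x : E) : differentiable f x ->
  is_diff x (height f v) (fun w => dot ('d f x w) v).
Proof.
move=> fd.
have dotv_linear : linear (fun u : E => dot u v : R).
  by move=> a u w; rewrite dotDl dotZl.
pose dotvM := GRing.isLinear.Build _ _ _ _ _ dotv_linear.
pose dotv : {linear E -> R} := HB.pack (fun u : E => dot u v : R) dotvM.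
have dotv_cont : continuous dotv by apply: dot_cont; [exact: id_cont|exact: cst_cont].
have dd : differentiable dotv (f x) by exact: linear_differentiable.
have -> : height f v = dotv \o f by [].
apply: DiffDef; first exact: (differentiable_comp fd dd).
have dl : 'd dotv (f x) = dotv :> (E -> R) by exact: diff_lin.
apply/funext => w; have := congr1 (fun k : E -> R => k w) (diff_comp fd dd) => /= e.
exact: etrans e (congr1 (fun k : E -> R => k ('d f x w)) dl).
Qed.

Lemma slope_bound_push (f : E -> E) : local_diffeomorphism f ->
  (forall v : E, unit_sphere v -> exists g : E -> 'M[R]_n,
     [/\ riemannian_metric g, complete_metric g &
         0 < inf (range (fun x => metric_norm g x (gradient g (height f v) x)))]) ->
  forall y, pushable (fun x => f x - y).
Proof.
move=> f_ld f_grad y v eps K v0 eps0 Kc.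
have vv := dot_gt0 v0; pose nv := Num.sqrt (dot v v).
have nv0 : 0 < nv by rewrite sqrtr_gt0.
have unv : unit_sphere (nv^-1 *: v).
  rewrite /unit_sphere /= dotZl dotC dotZl mulrA -invfM -expr2 sqr_sqrtr ?ltW//.
  by rewrite mulVf ?sqrtr1// gt_eqF.
set u := nv^-1 *: v in unv.
have vu : v = nv *: u by rewrite scalerA mulfV ?scale1r// gt_eqF.
have [g [g_riem g_compl c0]] := f_grad u unv; set c := inf _ in c0.
have c_le x : c <= metric_norm g x (gradient g (height f u) x).
  apply: ge_inf; last by exists x.
  by exists 0 => _ [z _ <-]; exact: metric_norm_ge0.
have fd x := local_diffeo_differentiable f_ld x.
pose A x : E := \row_i dot ('d f x (delta_mx 0 i)) u.
have A_cont : continuous A.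
  apply: mx_continuous => i j; under eq_fun do rewrite mxE.
  by apply: dot_cont; [exact: local_diffeo_diff_continuous|exact: cst_cont].
have hA x w : 'd (height f u) x w = dot (A x) w.
  have [_ ->] := is_diff_height u (fd x).
  rewrite {1}(row_sum_delta w) linear_sum /=.
  have dot_sum (F : 'I_n -> E) : dot (\sum_(i < n) F i) u = \sum_(i < n) dot (F i) u.
    elim/big_ind2: _ => [|a1 b1 a2 b2 <- <-|//]; last exact: dotDl.
    by rewrite /dot big1// => i _; rewrite mxE mul0r.
  rewrite dot_sum [RHS]/dot; apply: eq_bigr => i _.
  by rewrite linearZ /= dotZl mxE mulrC.
have hd x : differentiable (height f u) x by case: (is_diff_height u (fd x)).
have heightE x : dot (f x - y) v = nv * (height f u x - dot y u).
  have dv w : dot w v = nv * dot w u by rewrite dotC vu dotZl dotC.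
  by rewrite dotBl !dv -mulrBr.
(* For the unit vector u = v / |v|, the condition <f x - y, v> >= eps becomes f_u x >= <y, u> + eps
   / |v|. *)
have [r [rc rid rK]] := ascending_push g_riem g_compl hd hA A_cont c0 c_le (dot y u)
  (divr_gt0 eps0 nv0) Kc.
exists r; split=> // x.
- rewrite heightE mulrC -ler_pdivrMr// => H; apply: rid; by rewrite addrC -lerBrDr.
- by move=> Kx; rewrite heightE mulr_gt0// subr_gt0; exact: rK.
Qed.

End Height.

Theorem corollary5p1 (R : realType) (n : nat) (f : 'rV[R]_n -> 'rV[R]_n)
    (f_loc_diffeo : local_diffeomorphism f)
    (f_grad : forall v : 'rV[R]_n, unit_sphere v ->
       exists g : 'rV[R]_n -> 'M[R]_n,
         [/\ riemannian_metric g, complete_metric g &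
             0 < inf (range (fun x =>
                   metric_norm g x (gradient g (height f v) x)))]) :
  bijective f.
Proof. by apply: pushable_bijective => //; exact: slope_bound_push. Qed.
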